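(* Let $\mathcal V$ be a variety of $R$-modules expanded by multilinear operations named by $F$, and let $M\in\mathcal V$ be an extension $0\to I\to M\stackrel{\pi}{\to}Q\to 0$ with associated 2-cocycle $T$. Let $(M,A,\ast)$ be affine datum in $\mathcal V$. Then there is an exact sequence of abelian groups $$0\longrightarrow H^1(Q,A^I,\hat\ast)\stackrel{\sigma}{\longrightarrow}H^1(M,A^I,\ast)\stackrel{r}{\longrightarrow}H^1(I,A^I,\ast)^{\square}\stackrel{\delta_T}{\longrightarrow}H^2_{\mathcal V}(Q,A^I,\hat\ast)\stackrel{\sigma}{\longrightarrow}H^2_{\mathcal V}(M,A^I,\ast),$$ where $\sigma$ are the inflation maps, $r$ is the restriction map and $\delta_T$ is the transgression map.
   Context: $R$ is a fixed ring, $F$ a set of operation symbols of finite positive arities $\mathrm{ar} f$, and ${}_R\mathcal M_F$ is the variety of all $R$-modules expanded by an $R$-multilinear operation for each $f\in F$, in the signature $\{+,-,0\}\cup R\cup F$. A variety of $R$-modules expanded by multilinear operations is a subvariety of ${}_R\mathcal M_F$. An ideal is a submodule $K$ with $f(\vec x)\in K$ whenever some $x_i\in K$. $[n]=\{1,\dots,n\}$, $[n]^\ast$ is the set of nonempty proper subsets of $[n]$, and for tuples $\vec q_s[\vec p]$ is $\vec q$ with the coordinates in $s$ replaced by those of $\vec p$. 2-cocycles. For algebras $P,B\in\mathcal V$ a 2-cocycle $S$ for $(P,B)$ consists of factor sets $S_+:P^2\to B$, $S_r:P\to B$ $(r\in R)$, $S_f:P^{\mathrm{ar} f}\to B$ $(f\in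 F)$ with $S_+(x,0)=S_+(0,x)=0$, $S_r(0)=0$, $S_f(\vec x)=0$ if some $x_i=0$, and action terms $a(f,s):P^{n}\times B^{n}\to B$ ($f\in F$, $n=\mathrm{ar} f$, $s\in[n]^\ast$), where $a(f,s)(\vec q,\vec b)$ depends only on $q_j$ ($j\notin s$) and $b_j$ ($j\in s$), is $R$-multilinear in the $b_j$, $j\in s$, and vanishes if $q_j=0$ for some $j\notin s$. $B\rtimes_SP$ is the algebra on $B\times P$ with $\langle a,x\rangle+\langle b,y\rangle=\langle a+b+S_+(x,y),x+y\rangle$, $-\langle a,x\rangle=\langle -a-S_+(x,-x),-x\rangle$, $r\cdot\langle a,x\rangle=\langle r\cdot a+S_r(x),r\cdot x\rangle$, and $F_f(\langle a_1,x_1\rangle,\dots,\langle a_n,x_n\rangle)=\langle f^B(\vec a)+\sum_{s\in[n]^\ast}a(f,s)(\vec x,\vec a)+S_f(\vec x),f^P(\vec x)\rangle$. $S$ is $\mathcal V$-compatible if $B\rtimes_SP\in\mathcal V$. An action (family of action terms) $\ast$ is $\mathcal V$-compatible if the 2-cocycle with action $\ast$ and zero factor sets is; the corresponding algebra is $B\rtimes_\ast P$. Affine datum. $(P,B,\ast)$ is affine datum in $\mathcal V$ if $P,B\in\mathcal V$, $B$ is abelian (every $f^B$ is identically zero), $\ast$ is $\mathcal V$-compatible and $a(f,s)=0$ for $|s|\ge2$; write $a(f,i)=a(f,\{i\})$ (for unary $f$ there are none, and sums over $i$ are then $0$). The same notion of derivation and of $H^1$ is used for $I$ acting through $\ast$.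 Cohomology of affine datum $(P,B,\ast)$. A derivation is an $R$-module homomorphism $d:P\to B$ with $d(f^P(\vec x))=\sum_i a(f,i)(\vec x,d(\vec x))$ for all $f\in F$; $\mathrm{Der}(P,B,\ast)$ is the abelian group of these. A derivation $d$ is principal if $\gamma(\langle a,x\rangle)=\langle a-d(x),x\rangle$, an automorphism of $B\rtimes_\ast P$, has a fixed point and there are a term $t(x,\vec y)$ and tuples $\vec c,\vec e$ from $B\times\{0\}$ with $\gamma(z)=t(z,\vec c)$ and $z=t(z,\vec e)$ for all $z\in B\rtimes_\ast P$. $\mathrm{PDer}(P,B,\ast)$ is the subgroup of principal derivations and $H^1(P,B,\ast)=\mathrm{Der}(P,B,\ast)/\mathrm{PDer}(P,B,\ast)$. $H^2_{\mathcal V}(P,B,\ast)$ is the abelian group (adding factor sets) of $\mathcal V$-compatible 2-cocycles with action $\ast$, modulo $S\sim S'$ iff there is $h:P\to B$ with $h(0)=0$, $(S-S')_+(x,y)=h(x)+h(y)-h(x+y)$, $(S-S')_r(x)=r\cdot h(x)-h(r\cdot x)$, $(S-S')_f(\vec x)=\sum_i a(f,i)(\vec x,h(\vec x))-h(f^P(\vec x))$. The extension. Choosing a lifting $l:Q\to M$ of $\pi$ with $l(0)=0$ determines the $\mathcal V$-compatible 2-cocycle $T$ of $(Q,I)$: $T_+(x,y)=l(x)+l(y)-l(x+y)$, $T_r(x)=r\cdot l(x)-l(r\cdot x)$, $T_f(\vec x)=f^M(l(\vec x))-l(f^Q(\vec x))$, with action terms denoted $b(f,s)(\vec x,\vec b)=f^M(l(\vec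 x)_s[\vec b])$. Identify $M=I\rtimes_TQ$, $I=I\times\{0\}$, $l(x)=\langle 0,x\rangle$. Null submodule and induced action. Let $a(f,i)$ be the action terms of $M\ast A$. $\mathcal S^\ast$ is the smallest set of operations containing all $a(f,i)$ and closed under $t(x,\vec y)\mapsto a(f,i)(z_1,\dots,z_{i-1},t(x,\vec y),z_{i+1},\dots,z_{\mathrm{ar} f})$ ($x$ ranging over $A$, the other variables over $M$). $A^I=\{a\in A: t(a,\vec m)=0\text{ for all }t\in\mathcal S^\ast\text{ whenever some }m_j\in I\}$, a submodule of $A$, closed under $\ast$; $\ast$ also denotes the restricted actions of $M$ and of $I$ on $A^I$. The action $\hat\ast$ of $Q$ on $A^I$ is $\hat a(f,i)(\pi(\vec m),\vec a)=a(f,i)(\vec m,\vec a)$ for $\vec m\in M^{\mathrm{ar} f}$, $\vec a\in (A^I)^{\mathrm{ar} f}$; it is well defined and $(Q,A^I,\hat\ast)$ is affine datum in $\mathcal V$. $\square$-condition. $d\in\mathrm{Der}(I,A^I,\ast)$ satisfies the $\square$-condition if there is $h:Q\to A^I$ with, for all $f\in F$, $s\in[\mathrm{ar} f]^\ast$, $\vec x\in Q^{\mathrm{ar} f}$, $\vec b\in I^{\mathrm{ar} f}$, $$d(b(f,s)(\vec x,\vec b))=\sum_{i\notin s}a(f,i)(\vec u,h(\vec x))+\sum_{i\in s}a(f,i)(\vec u,d(\vec b)),$$ where $u_j=\langle b_j,0\rangle$ for $j\in s$ and $u_j=\langle 0,x_j\rangle$ for $j\notin s$. $H^1(I,A^I,\ast)^\square$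 is the subgroup of classes $[d]$ with $d$ satisfying the $\square$-condition. Maps. Inflation: $\sigma([d])=[d\circ\pi]$ on $H^1$ and $\sigma([S])=[S\circ\pi]$ on $H^2$, where $S\circ\pi$ has factor sets $S_+(\pi(x),\pi(y))$, $S_r(\pi(x))$, $S_f(\pi(\vec x))$ and action $\ast$. Restriction: $r([d])=[d|_I]$. Transgression: $\delta_T([d])=[d\circ T]$, where $d\circ T$ has factor sets $d\circ T_+,d\circ T_r,d\circ T_f$ and action $\hat\ast$. *)

(* Defs.v *)
From HB Require Import structures.
From mathcomp Require Import all_boot all_order all_algebra.
From mathcomp Require Import boolp functions.

Set Implicit Arguments.
Unset Strict Implicit.
Unset Printing Implicit Defensive.

Import GRing.Theory.
Local Open Scope ring_scope.
Local Open Scope quotient_scope.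

Definition upd (n : nat) (T : Type) (v : 'I_n -> T) (i : 'I_n) (x : T) : 'I_n -> T :=
  fun j => if j == i then x else v j.

(* [n]^*: the nonempty proper subsets of the index set. *)
Definition nontrivial (n : nat) (s : {set 'I_n}) : bool :=
  (s != set0) && (s != setT).

Section UniversalAlgebra.
Context {R : pzRingType} {F : Type} (ar : F -> nat).

Inductive term (X : Type) : Type :=
| Var of X
| Zero
| Add of term X & term X
| Opp of term X
| Scale of R & term X
| App (f : F) of ('I_(ar f) -> term X).

(* A raw algebra in the signature {+,-,0} u R u F; no identity is imposed. *)
Record algebra := MkAlgebra {
  carrier :> Type;
  alg_zero : carrier;
  alg_add : carrier -> carrier -> carrier;
  alg_opp : carrier -> carrier;
  alg_scale : R -> carrier -> carrier;
  alg_op : forall f : F, ('I_(ar f) -> carrier) -> carrier }.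

Fixpoint eval (A : algebra) (X : Type) (v : X -> A) (t : term X) : A :=
  match t with
  | Var x => v x
  | Zero => alg_zero A
  | Add t u => alg_add (eval v t) (eval v u)
  | Opp t => alg_opp (eval v t)
  | Scale r t => alg_scale r (eval v t)
  | App f ts => alg_op (fun i => eval v (ts i))
  end.

(* The identities axiomatizing R-modules expanded by R-multilinear operations. *)
Inductive RMF_axiom : term nat -> term nat -> Prop :=
| ax_addA : RMF_axiom (Add (Var 0%N) (Add (Var 1%N) (Var 2%N)))
                      (Add (Add (Var 0%N) (Var 1%N)) (Var 2%N))
| ax_addC : RMF_axiom (Add (Var 0%N) (Var 1%N)) (Add (Var 1%N) (Var 0%N))
| ax_add0 : RMF_axiom (Add (Zero _) (Var 0%N)) (Var 0%N)
| ax_addN : RMF_axiom (Add (Opp (Var 0%N)) (Var 0%N)) (Zero _)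
| ax_scaleA r s : RMF_axiom (Scale r (Scale s (Var 0%N))) (Scale (r * s) (Var 0%N))
| ax_scale1 : RMF_axiom (Scale 1 (Var 0%N)) (Var 0%N)
| ax_scaleDr r : RMF_axiom (Scale r (Add (Var 0%N) (Var 1%N)))
                           (Add (Scale r (Var 0%N)) (Scale r (Var 1%N)))
| ax_scaleDl r s : RMF_axiom (Scale (r + s) (Var 0%N))
                             (Add (Scale r (Var 0%N)) (Scale s (Var 0%N)))
| ax_opD f (i : 'I_(ar f)) :
    let xs := fun j : 'I_(ar f) => Var (j : nat) in
    RMF_axiom (App (upd xs i (Add (Var (i : nat)) (Var (ar f)))))
              (Add (App xs) (App (upd xs i (Var (ar f)))))
| ax_opZ f (i : 'I_(ar f)) r :
    let xs := fun j : 'I_(ar f) => Var (j : nat) in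
    RMF_axiom (App (upd xs i (Scale r (Var (i : nat))))) (Scale r (App xs)).

(* The subvariety of _R M_F defined by a set E of identities. *)
Definition in_variety (E : term nat -> term nat -> Prop) (A : algebra) : Prop :=
  forall t u, RMF_axiom t u \/ E t u -> forall v : nat -> A, eval v t = eval v u.

(* An R-module with operations named by F; multilinearity is not built in, it
   is part of [in_variety]. *)
Record xmod := Xmod {
  xsort :> lmodType R;
  xop : forall f : F, ('I_(ar f) -> xsort) -> xsort }.

Definition algebra_of (A : xmod) : algebra :=
  MkAlgebra 0 +%R -%R *:%R (@xop A).

Record xmod_hom (A B : xmod) (phi : A -> B) : Prop := XmodHom {
  xhom_linear : linear phi;
  xhom_op : forall f (x : 'I_(ar f) -> A), phi (xop x) = xop (fun i => phi (x i)) }.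

Record is_extension (E : term nat -> term nat -> Prop) (I M Q : xmod)
    (iota : I -> M) (pi : M -> Q) : Prop := IsExtension {
  ext_variety : in_variety E (algebra_of M);
  ext_iota : xmod_hom iota;
  ext_pi : xmod_hom pi;
  ext_inj : injective iota;
  ext_surj : forall x, exists m, pi m = x;
  ext_exact : forall m, pi m = 0 <-> exists b, iota b = m }.

End UniversalAlgebra.

Arguments term R {F} ar X.
Arguments algebra R {F} ar.
Arguments xmod R {F} ar.
Arguments Zero {R F ar X}.

Section Preservation.
Context {R : pzRingType} {F : Type} {ar : F -> nat}.
Implicit Types A B : algebra R ar.

Record alg_hom A B (phi : A -> B) : Prop := AlgHom {
  ahom0 : phi (alg_zero A) = alg_zero B;
  ahomD : forall x y, phi (alg_add x y) = alg_add (phi x) (phi y);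
  ahomN : forall x, phi (alg_opp x) = alg_opp (phi x);
  ahomZ : forall r x, phi (alg_scale r x) = alg_scale r (phi x);
  ahom_op : forall f (x : 'I_(ar f) -> A), phi (alg_op x) = alg_op (fun i => phi (x i)) }.

Lemma eval_hom A B (phi : A -> B) X (v : X -> A) (t : term R ar X) :
  alg_hom phi -> phi (eval v t) = eval (fun x => phi (v x)) t.
Proof.
move=> [h0 hD hN hZ ho]; elim: t => //= [t IHt u IHu|t IHt|r t IHt|f ts IH].
- by rewrite hD IHt IHu.
- by rewrite hN IHt.
- by rewrite hZ IHt.
- by rewrite ho; congr alg_op; apply/funext => i; apply: IH.
Qed.

Fixpoint rename X Y (g : X -> Y) (t : term R ar X) : term R ar Y :=
  match t with
  | Var x => Var ar (g x)
  | Zero => Zero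
  | Add t u => Add (rename g t) (rename g u)
  | Opp t => Opp (rename g t)
  | Scale r t => Scale r (rename g t)
  | App f ts => App (fun i => rename g (ts i))
  end.

Lemma eval_renameE A X Y (g : X -> Y) (v : Y -> A) (t : term R ar X) :
  eval v (rename g t) = eval (fun x => v (g x)) t.
Proof.
elim: t => //= [t IHt u IHu|t IHt|r t IHt|f ts IH].
- by rewrite IHt IHu.
- by rewrite IHt.
- by rewrite IHt.
- by congr alg_op; apply/funext => i; apply: IH.
Qed.

Lemma in_variety_inj E A B (phi : A -> B) :
  alg_hom phi -> injective phi -> in_variety E B -> in_variety E A.
Proof. by move=> hphi ip hB t u tu v; apply: ip; rewrite !eval_hom//; apply: hB. Qed.

Lemma in_variety_surj E A B (phi : A -> B) :
  alg_hom phi -> (forall y, exists x, phi x = y) -> in_variety E A -> in_variety E B.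
Proof.
move=> hphi sp hA t u tu v.
have [g gE] := choice sp.
have -> : v = (fun x => phi (g (v x))) by apply/funext => x; rewrite gE.
by rewrite -!(eval_hom _ _ hphi) (hA _ _ tu).
Qed.

End Preservation.

Section Cocycles.
Context {R : pzRingType} {F : Type} {ar : F -> nat}.

Record factors (P B : xmod R ar) := Factors {
  fs_add : P -> P -> B;
  fs_scale : R -> P -> B;
  fs_op : forall f : F, ('I_(ar f) -> P) -> B }.

Definition action (P B : xmod R ar) : Type :=
  forall f : F, {set 'I_(ar f)} -> ('I_(ar f) -> P) -> ('I_(ar f) -> B) -> B.

Section FactorGroup.
Variables P B : xmod R ar.
Implicit Types S : factors P B.

Lemma factorsP S S' :
  (forall x y, fs_add S x y = fs_add S' x y) ->
  (forall r x, fs_scale S r x = fs_scale S' r x) ->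
  (forall f x, fs_op S (f := f) x = fs_op S' x) -> S = S'.
Proof.
case: S S' => [p q o] [p' q' o'] /= hp hq ho; congr Factors.
- by apply/funext => x; apply/funext => y.
- by apply/funext => x; apply/funext => y.
- by apply: functional_extensionality_dep => f; apply/funext => x.
Qed.

HB.instance Definition _ := gen_eqMixin (factors P B).
HB.instance Definition _ := gen_choiceMixin (factors P B).

Definition factors_zero : factors P B :=
  Factors (fun _ _ => 0) (fun _ _ => 0) (fun _ _ => 0).
Definition factors_add S S' : factors P B :=
  Factors (fun x y => fs_add S x y + fs_add S' x y)
    (fun r x => fs_scale S r x + fs_scale S' r x)
    (fun f x => fs_op S x + fs_op S' x).
Definition factors_opp S : factors P B :=
  Factors (fun x y => - fs_add S x y) (fun r x => - fs_scale S r x)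
    (fun f x => - fs_op S x).

Lemma factors_addA : associative factors_add.
Proof. by move=> *; apply: factorsP => * /=; rewrite addrA. Qed.
Lemma factors_addC : commutative factors_add.
Proof. by move=> *; apply: factorsP => * /=; rewrite addrC. Qed.
Lemma factors_add0 : left_id factors_zero factors_add.
Proof. by move=> *; apply: factorsP => * /=; rewrite add0r. Qed.
Lemma factors_addN : left_inverse factors_zero factors_opp factors_add.
Proof. by move=> *; apply: factorsP => * /=; rewrite addNr. Qed.

HB.instance Definition _ :=
  GRing.isZmodule.Build (factors P B) factors_addA factors_addC factors_add0 factors_addN.

End FactorGroup.

Record normalized (P B : xmod R ar) (S : factors P B) : Prop := Normalized {
  norm_addr : forall x, fs_add S x 0 = 0;
  norm_addl : forall x, fs_add S 0 x = 0;
  norm_scale : forall r, fs_scale S r 0 = 0;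
  norm_op : forall f (x : 'I_(ar f) -> P), (exists i, x i = 0) -> fs_op S x = 0 }.

(* Only the values a f s with s in [n]^* matter; the others are junk. *)
Record action_terms (P B : xmod R ar) (a : action P B) : Prop := ActionTerms {
  act_dep : forall f s, nontrivial s ->
    forall (q q' : 'I_(ar f) -> P) (b b' : 'I_(ar f) -> B),
    (forall j, j \notin s -> q j = q' j) -> (forall j, j \in s -> b j = b' j) ->
    a f s q b = a f s q' b';
  act_lin : forall f s, nontrivial s ->
    forall (q : 'I_(ar f) -> P) (b : 'I_(ar f) -> B) j, j \in s ->
    linear (fun x : B => a f s q (upd b j x));
  act_vanish : forall f s, nontrivial s ->
    forall (q : 'I_(ar f) -> P) (b : 'I_(ar f) -> B),
    (exists2 j, j \notin s & q j = 0) -> a f s q b = 0 }.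

(* The algebra B x|_S P, for the 2-cocycle S with factor sets S and action a. *)
Definition cocycle_ext (P B : xmod R ar) (S : factors P B) (a : action P B) : algebra R ar :=
  @MkAlgebra R F ar (B * P)%type (0, 0)
    (fun u v => (u.1 + v.1 + fs_add S u.2 v.2, u.2 + v.2))
    (fun u => (- u.1 - fs_add S u.2 (- u.2), - u.2))
    (fun r u => (r *: u.1 + fs_scale S r u.2, r *: u.2))
    (fun f u =>
      (xop (fun i => (u i).1)
       + \sum_(s : {set 'I_(ar f)} | nontrivial s)
           a f s (fun i => (u i).2) (fun i => (u i).1)
       + fs_op S (fun i => (u i).2),
       xop (fun i => (u i).2))).

Definition semidirect (P B : xmod R ar) (a : action P B) : algebra R ar :=
  cocycle_ext 0 a.

Record affine_datum (E : term R ar nat -> term R ar nat -> Prop) (P B : xmod R ar) :=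
  AffineDatum {
  act :> action P B;
  datum_terms : action_terms act;
  datum_P : in_variety E (algebra_of P);
  datum_B : in_variety E (algebra_of B);
  datum_abelian : forall f (x : 'I_(ar f) -> B), xop x = 0;
  datum_compat : in_variety E (semidirect act);
  datum_unary : forall f s, nontrivial s -> (1 < #|s|)%N ->
    forall (q : 'I_(ar f) -> P) (b : 'I_(ar f) -> B), act s q b = 0 }.

(* a(f,i) = a(f,{i}); for unary f the set {i} is not in [1]^* and there are no
   action terms, so that sums over i are 0. *)
Definition act1 (P B : xmod R ar) (a : action P B) (f : F) (i : 'I_(ar f))
    (q : 'I_(ar f) -> P) (b : 'I_(ar f) -> B) : B :=
  if (1 < ar f)%N then a f [set i] q b else 0.

End Cocycles.
Arguments act1 {R F ar P B} a {f} i q b.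

Lemma nontrivial1 n (i : 'I_n) : nontrivial [set i] = (1 < n)%N.
Proof.
rewrite /nontrivial -cards_eq0 cards1 /= eqEcard subsetT cardsT card_ord cards1.
by rewrite /= -ltnNge.
Qed.

Arguments act {R F ar E P B} _ f s q b : rename.
Arguments datum_compat {R F ar E P B} _ [t u] _ v.
Arguments datum_P {R F ar E P B} _ [t u] _ v.
Arguments datum_B {R F ar E P B} _ [t u] _ v.

Section AffineTheory.
Context {R : pzRingType} {F : Type} {ar : F -> nat}.
Context {E : term R ar nat -> term R ar nat -> Prop} {P B : xmod R ar}.
Variable D : affine_datum E P B.

Lemma act1_lin f (i : 'I_(ar f)) q (u v : 'I_(ar f) -> B) r :
  act1 D i q (fun j => r *: u j + v j) = r *: act1 D i q u + act1 D i q v.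
Proof.
rewrite /act1; case: ifP => [n1|_]; last by rewrite scaler0 addr0.
have nt : nontrivial [set i] by rewrite nontrivial1.
have eqb (w : 'I_(ar f) -> B) : act D f [set i] q w = act D f [set i] q (upd (fun=> 0) i (w i)).
  apply: (act_dep (datum_terms D)) => // j; rewrite inE => /eqP ->.
  by rewrite /upd eqxx.
rewrite eqb [in RHS]eqb [act D _ _ _ v]eqb.
by have := act_lin (datum_terms D) nt q (fun=> 0) (set11 i) => /= ->.
Qed.

Lemma act1D f (i : 'I_(ar f)) q (u v : 'I_(ar f) -> B) :
  act1 D i q (fun j => u j + v j) = act1 D i q u + act1 D i q v.
Proof.
rewrite -[act1 D i q u]scale1r -act1_lin; congr (act1 D i q _).
by apply/funext => j; rewrite scale1r.
Qed.

Lemma act1_0 f (i : 'I_(ar f)) q : act1 D i q (fun=> 0) = 0.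
Proof.
apply: (addrI (act1 D i q (fun=> 0))); rewrite addr0 -act1D.
by congr (act1 D i q _); apply/funext => j; rewrite addr0.
Qed.

Lemma act1B f (i : 'I_(ar f)) q (u v : 'I_(ar f) -> B) :
  act1 D i q (fun j => u j - v j) = act1 D i q u - act1 D i q v.
Proof.
apply/eqP; rewrite -subr_eq opprK eq_sym; apply/eqP; rewrite -act1D.
by congr (act1 D i q _); apply/funext => j; rewrite subrK.
Qed.

Lemma sum_action f q (b : 'I_(ar f) -> B) :
  \sum_(s : {set 'I_(ar f)} | nontrivial s) act D f s q b = \sum_i act1 D i q b.
Proof.
transitivity (\sum_i \sum_(s : {set 'I_(ar f)} | nontrivial s && (s == [set i])) act D f s q b); last first.
  apply: eq_bigr => i _; rewrite /act1.
  case: ifP => n1.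
    rewrite (big_pred1 [set i])// => s /=.
    by case: eqP => [->|_]; rewrite ?nontrivial1 ?n1 ?andbF.
  by rewrite big_pred0// => s; case: eqP => [->|_]; rewrite ?nontrivial1 ?n1 ?andbF.
rewrite (exchange_big_dep (@nontrivial _)) /=; last by move=> i s _ /andP[].
apply: eq_bigr => s nts; have [s1|] := boolP (#|s| == 1)%N.
  have /cards1P[i si] := s1; subst s.
  rewrite (big_pred1 i)// => j /=; rewrite nts /=.
  by apply/eqP/eqP => [/set1_inj ->|->].
move=> s1; rewrite big1 => [|i /andP[_ /eqP si]]; last by rewrite si cards1 in s1.
apply: datum_unary => //.
have /andP[+ _] := nts; rewrite -cards_eq0.
by case: #|s| s1 => [|[|]].
Qed.

End AffineTheory.

Lemma linear_at0 {R : pzRingType} (U V : lmodType R) (d : U -> V) :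
  linear d -> d 0 = 0.
Proof. by move=> /(_ (-1) 0 0); rewrite scaler0 addr0 scaleN1r addNr. Qed.

Section FirstCohomology.
Context {R : pzRingType} {F : Type} {ar : F -> nat}.
Context {E : term R ar nat -> term R ar nat -> Prop} {P B : xmod R ar}.
Variable D : affine_datum E P B.

Definition derivation (d : P -> B) : Prop :=
  linear d /\
  forall f (x : 'I_(ar f) -> P), d (xop x) = \sum_i act1 D i x (fun j => d (x j)).

Definition der_pred : {pred P -> B} := fun d => `[< derivation d >].

Let fun0E x : (0 : P -> B) x = 0. Proof. by []. Qed.
Let funBE (d e : P -> B) x : (d - e) x = d x - e x. Proof. by []. Qed.

Lemma der_zmod_closed : zmod_closed der_pred.
Proof.
split=> [|d e /asboolP[dl df] /asboolP[el ef]]; apply/asboolP; split.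
- by move=> r u v; rewrite !fun0E scaler0 addr0.
- by move=> f x; rewrite fun0E big1// => i _; apply: act1_0.
- move=> r u v; rewrite !funBE dl el scalerBr opprD.
  by rewrite addrACA.
- move=> f x; rewrite !funBE df ef -sumrB; apply: eq_bigr => i _.
  by rewrite -act1B.
Qed.
HB.instance Definition _ := GRing.isZmodClosed.Build (P -> B) der_pred der_zmod_closed.

Record Der := MkDer { der_fun :> P -> B; _ : der_fun \in der_pred }.
HB.instance Definition _ := [isSub for der_fun].
HB.instance Definition _ := [Choice of Der by <:].
HB.instance Definition _ := [SubChoice_isSubZmodule of Der by <:].

Definition gamma (d : P -> B) (z : semidirect D) : semidirect D := (z.1 - d z.2, z.2).

(* The polynomial z |-> t(z, c) with parameters c_j = <c j, 0>. *)
Definition poly_eval (k : nat) (t : term R ar (option 'I_k)) (c : 'I_k -> B)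
    (z : semidirect D) : semidirect D :=
  eval (fun o => if o is Some j then ((c j, 0) : semidirect D) else z) t.

Definition principal (d : P -> B) : Prop :=
  (exists z, gamma d z = z) /\
  exists (k : nat) (t : term R ar (option 'I_k)) (c e : 'I_k -> B),
    forall z, gamma d z = poly_eval t c z /\ z = poly_eval t e z.

Definition pder_pred : {pred Der} := fun d => `[< principal d >].

Lemma pder_zmod_closed : zmod_closed pder_pred.
Proof.
split=> [|d d'].
  apply/asboolP; split.
    by exists (0, 0); rewrite /gamma /= subr0.
  exists 0%N, (Var ar None), (fun=> 0), (fun=> 0) => -[a x].
  by rewrite /gamma /poly_eval /= subr0.
move=> /asboolP[_ [k [t [c [e tE]]]]] /asboolP[_ [k' [t' [c' [e' tE']]]]].
apply/asboolP; split.
  have /asboolP[/linear_at0 d0 _] := valP (d - d').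
  by exists (0, 0); congr pair; rewrite -[RHS]subr0; congr (_ - _); apply: d0.
pose l (o : option 'I_k) : option 'I_(k + k') := omap (lshift k') o.
pose r (o : option 'I_k') : option 'I_(k + k') := omap (@rshift k k') o.
pose glue (u : 'I_k -> B) (u' : 'I_k' -> B) (j : 'I_(k + k')) :=
  match fintype.split j with inl i => u i | inr i => u' i end.
have evl u u' z : poly_eval (rename l t) (glue u u') z = poly_eval t u z.
  rewrite /poly_eval eval_renameE; congr eval; apply/funext => -[j|] //=.
  by rewrite /glue -[lshift _ _]/(unsplit (inl j)) unsplitK.
have evr u u' z : poly_eval (rename r t') (glue u u') z = poly_eval t' u' z.
  rewrite /poly_eval eval_renameE; congr eval; apply/funext => -[j|] //=.
  by rewrite /glue -[rshift _ _]/(unsplit (inr j)) unsplitK.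
exists (k + k')%N, (Add (Add (rename l t) (Opp (rename r t'))) (Var ar None)),
  (glue c c'), (glue e e') => -[a x].
split.
  rewrite /poly_eval /= -/(poly_eval _ _ _) -/(poly_eval _ _ _) evl evr.
  rewrite -(proj1 (tE _)) -(proj1 (tE' _)) /gamma /=.
  rewrite !subr0 !addr0 subrr add0r; congr pair.
  have dE : val (d - d') x = d x - d' x by rewrite raddfB.
  transitivity (a - (d x - d' x)); first by congr (_ - _); exact: dE.
  by rewrite !opprB -[RHS]addrA addrNK addrA addrAC.
rewrite /poly_eval /= -/(poly_eval _ _ _) -/(poly_eval _ _ _) evl evr.
rewrite -(proj2 (tE _)) -(proj2 (tE' _)) /=.
by rewrite !subr0 !addr0 !subrr !add0r.
Qed.
HB.instance Definition _ := GRing.isZmodClosed.Build Der pder_pred pder_zmod_closed.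

Definition H1 := Quotient.quot pder_pred.
HB.instance Definition _ := GRing.Zmodule.on H1.

Definition class1 (d : Der) : H1 := \pi d.

End FirstCohomology.

Section SecondCohomology.
Context {R : pzRingType} {F : Type} {ar : F -> nat}.
Context {E : term R ar nat -> term R ar nat -> Prop} {P B : xmod R ar}.
Variable D : affine_datum E P B.

(* Given the action of D, a compatible 2-cocycle is determined by its factor sets. *)
Definition compatible_cocycle (S : factors P B) : Prop :=
  normalized S /\ in_variety E (cocycle_ext S D).

(* The deviation of the value of t in B x|_S P from its value in B x|_* P. *)
Fixpoint deviation (S : factors P B) (X : Type) (v : X -> P) (t : term R ar X) : B :=
  let ev := eval (A := algebra_of P) v in
  match t with
  | Var x => 0
  | Zero => 0
  | Add t u => deviation S v t + deviation S v u + fs_add S (ev t) (ev u)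
  | Opp t => - deviation S v t - fs_add S (ev t) (- ev t)
  | Scale r t => r *: deviation S v t + fs_scale S r (ev t)
  | App f ts => \sum_i act1 D i (fun j => ev (ts j)) (fun j => deviation S v (ts j))
                + fs_op S (fun j => ev (ts j))
  end.

Lemma deviationB S S' X (v : X -> P) t :
  deviation (S - S') v t = deviation S v t - deviation S' v t.
Proof.
elim: t => [x||t IHt u IHu|t IHt|r t IHt|f ts IH] /=.
- by rewrite subr0.
- by rewrite subr0.
- rewrite IHt IHu !opprD [RHS]addrACA; congr (_ + _).
  by rewrite [RHS]addrACA.
- by rewrite IHt !opprD [RHS]addrACA.
- by rewrite IHt scalerBr opprD addrACA.
- rewrite opprD addrACA -sumrB; congr (_ + _); apply: eq_bigr => i _.
  by rewrite -act1B; congr (act1 D i _ _); apply/funext => j; apply: IH.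
Qed.

Lemma eval_cocycle_ext S X (v : X -> B * P) (t : term R ar X) :
  eval (A := cocycle_ext S D) v t =
  ((eval (A := semidirect D) v t).1 + deviation S (fun x => (v x).2) t,
   eval (A := algebra_of P) (fun x => (v x).2) t).
Proof.
have snd_eval S' u : (eval (A := cocycle_ext S' D) v u).2 =
    eval (A := algebra_of P) (fun x => (v x).2) u.
  exact: (@eval_hom _ _ _ (cocycle_ext S' D) (algebra_of P) (fun z => z.2)).
elim: t => [x||t IHt u IHu|t IHt|r t IHt|f ts IH] /=.
- by rewrite addr0; case: (v x).
- by rewrite addr0.
- rewrite IHt IHu /= ?snd_eval; congr pair.
  by rewrite addr0 [X in X + _]addrACA -[LHS]addrA.
- rewrite IHt /= ?snd_eval; congr pair.
  by rewrite subr0 opprD -[LHS]addrA.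
- rewrite IHt /= ?snd_eval; congr pair.
  by rewrite addr0 scalerDr -[LHS]addrA.
- have e1 : (fun i => (eval (A := cocycle_ext S D) v (ts i)).1) =
      (fun i => (eval (A := semidirect D) v (ts i)).1
                + deviation S (fun x => (v x).2) (ts i)).
    by apply/funext => i; rewrite IH.
  have e2 S' : (fun i => (eval (A := cocycle_ext S' D) v (ts i)).2) =
      (fun i => eval (A := algebra_of P) (fun x => (v x).2) (ts i)).
    by apply/funext => i; rewrite snd_eval.
  rewrite e1 (e2 S) (e2 0) !(datum_abelian D) !add0r !sum_action addr0 addrA.
  congr (_ + _, _); rewrite -big_split; apply: eq_bigr => i _ /=.
  exact: act1D.
Qed.

Lemma compatibleE S :
  in_variety E (cocycle_ext S D) <->
  (forall t u, RMF_axiom t u \/ E t u -> forall v : nat -> P,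
    deviation S v t = deviation S v u).
Proof.
split=> [hS t u tu v|hS t u tu v].
  have := hS t u tu (fun n => (0, v n)).
  rewrite (eval_cocycle_ext S _ t) (eval_cocycle_ext S _ u) => /(congr1 fst).
  by rewrite [LHS]/= [RHS]/= (datum_compat D tu) => /addrI.
rewrite (eval_cocycle_ext S _ t) (eval_cocycle_ext S _ u).
by rewrite (datum_compat D tu) (datum_P D tu) (hS t u tu).
Qed.

Definition z2_pred : {pred factors P B} := fun S => `[< compatible_cocycle S >].

Lemma z2_zmod_closed : zmod_closed z2_pred.
Proof.
split=> [|S S' /asboolP[nS cS] /asboolP[nS' cS']]; apply/asboolP; split.
- by split.
- exact: datum_compat.
- split=> [x|x|r|f x x0] /=.
  + by rewrite !norm_addr// subr0.
  + by rewrite !norm_addl// subr0.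
  + by rewrite !norm_scale// subr0.
  + by rewrite !norm_op// subr0.
- apply/compatibleE => t u tu v; rewrite !deviationB.
  move/compatibleE : cS => cS; move/compatibleE : cS' => cS'.
  by rewrite (cS t u tu) (cS' t u tu).
Qed.
HB.instance Definition _ := GRing.isZmodClosed.Build (factors P B) z2_pred z2_zmod_closed.

Record Z2 := MkZ2 { z2_factors :> factors P B; _ : z2_factors \in z2_pred }.
HB.instance Definition _ := [isSub for z2_factors].
HB.instance Definition _ := [Choice of Z2 by <:].
HB.instance Definition _ := [SubChoice_isSubZmodule of Z2 by <:].

Definition coboundary (S : factors P B) : Prop :=
  exists h : P -> B, [/\ h 0 = 0,
    forall x y, fs_add S x y = h x + h y - h (x + y),
    forall r x, fs_scale S r x = r *: h x - h (r *: x) &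
    forall f (x : 'I_(ar f) -> P),
      fs_op S x = \sum_i act1 D i x (fun j => h (x j)) - h (xop x)].

Definition b2_pred : {pred Z2} := fun S => `[< coboundary S >].

Lemma b2_zmod_closed : zmod_closed b2_pred.
Proof.
split=> [|S S' /asboolP[h [h0 hD hZ ho]] /asboolP[h' [h0' hD' hZ' ho']]]; apply/asboolP.
  exists (fun=> 0); split=> //= [x y|r x|f x].
  - by rewrite subr0 addr0.
  - by rewrite subr0 scaler0.
  - by rewrite subr0 big1// => i _; apply: act1_0.
exists (fun x => h x - h' x); split=> [|x y|r x|f x] /=.
- by rewrite h0 h0' subr0.
- by rewrite hD hD' !opprD addrACA [X in X + _]addrACA.
- by rewrite hZ hZ' scalerBr !opprD addrACA.
- rewrite ho ho' !opprD addrACA; congr (_ + _).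
  by rewrite -sumrB; apply: eq_bigr => i _; rewrite -act1B.
Qed.
HB.instance Definition _ := GRing.isZmodClosed.Build Z2 b2_pred b2_zmod_closed.

Definition H2 := Quotient.quot b2_pred.
HB.instance Definition _ := GRing.Zmodule.on H2.

Definition class2 (S : Z2) : H2 := \pi S.

End SecondCohomology.

Section ActionTheory.
Context {R : pzRingType} {F : Type} {ar : F -> nat}.
Context {E : term R ar nat -> term R ar nat -> Prop} {P B : xmod R ar}.
Variable D : affine_datum E P B.

Lemma act1_dep f (i : 'I_(ar f)) (q q' : 'I_(ar f) -> P) (b b' : 'I_(ar f) -> B) :
  (forall j, j != i -> q j = q' j) -> b i = b' i -> act1 D i q b = act1 D i q' b'.
Proof.
move=> hq hb; rewrite /act1; case: ifP => // n1.
apply: (act_dep (datum_terms D)); first by rewrite nontrivial1.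
  by move=> j; rewrite inE; apply: hq.
by move=> j; rewrite inE => /eqP ->.
Qed.

Lemma act1_b0 f (i : 'I_(ar f)) (q : 'I_(ar f) -> P) (b : 'I_(ar f) -> B) :
  b i = 0 -> act1 D i q b = 0.
Proof. by move=> b0; rewrite -(act1_0 D i q); apply: act1_dep. Qed.

Lemma act1_addq f (i j : 'I_(ar f)) (q : 'I_(ar f) -> P) m (b : 'I_(ar f) -> B) :
  j != i ->
  act1 D i (upd q j (q j + m)) b = act1 D i q b + act1 D i (upd q j m) b.
Proof.
move=> ji; pose c : 'I_(ar f) -> B := upd (fun=> 0) i (b i).
pose v (k : nat) : semidirect D :=
  if insub k is Some l then (c l, q l) else (0, m).
have vE (l : 'I_(ar f)) : v l = (c l, q l) by rewrite /v valK.
have vn : v (ar f) = (0, m) by rewrite /v insubF// ltnn.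
have opE (x : 'I_(ar f) -> P) (u : 'I_(ar f) -> semidirect D) :
    (forall l, u l = (c l, x l)) -> (alg_op u).1 = act1 D i x b.
  move=> uE; have -> : u = (fun l => (c l, x l)) by apply/funext => l; rewrite uE.
  rewrite /= (datum_abelian D) add0r addr0 sum_action (bigD1 i)//=.
  rewrite [X in _ + X]big1 ?addr0 => [|k ki]; last first.
    by apply: act1_b0; rewrite /c /upd (negPf ki).
  by apply: act1_dep; rewrite /c /upd// eqxx.
have := datum_compat D (or_introl (ax_opD j)) v => /(congr1 fst).
set lhs := eval _ _; set rhs := eval _ _.
have -> : lhs.1 = act1 D i (upd q j (q j + m)) b.
  apply: opE => l; rewrite /upd; case: eqP => [->|_] /=; last exact: vE.
  by rewrite vE vn /= /c /upd (negPf ji) !addr0.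
move=> ->; rewrite /rhs.
set u1 := App _; set u2 := App _.
have -> : (eval v (Add u1 u2)).1 = (eval v u1).1 + (eval v u2).1.
  exact: addr0.
congr (_ + _); apply: opE => l; first exact: vE.
rewrite /upd; case: eqP => [->|_] /=; last exact: vE.
by rewrite vn /c /upd (negPf ji).
Qed.

End ActionTheory.

Lemma algebra_of_hom {R : pzRingType} {F : Type} {ar : F -> nat} (A B : xmod R ar)
    (phi : A -> B) :
  xmod_hom phi -> alg_hom (A := algebra_of A) (B := algebra_of B) phi.
Proof.
move=> [phil phio]; have phi0 := linear_at0 phil.
have phiZ r x : phi (r *: x) = r *: phi x by have := phil r x 0; rewrite phi0 !addr0.
split=> //= [x y|x]; first by have := phil 1 x y; rewrite !scale1r.
by rewrite -scaleN1r phiZ scaleN1r.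
Qed.

Definition insert (n : nat) (T : Type) (i : 'I_n) (x : T) (y : 'I_n.-1 -> T) : 'I_n -> T :=
  fun j => if unlift i j is Some k then y k else x.

Section NullSubmodule.
Context {R : pzRingType} {F : Type} {ar : F -> nat}.
Context {E : term R ar nat -> term R ar nat -> Prop} {M A : xmod R ar}.
Variable D : affine_datum E M A.

(* The set S^*: [null_op t] for an operation t(x, y_1, ..., y_k), with x ranging
   over A and the y_j over M.  As a(f,i) does not depend on its i-th M-argument,
   that argument is not a variable of the operation (it is filled with 0). *)
Inductive null_op : forall k : nat, (A -> ('I_k -> M) -> A) -> Prop :=
| null_base f (i : 'I_(ar f)) : (1 < ar f)%N ->
    null_op (fun x (z : 'I_(ar f).-1 -> M) => act1 D i (insert i 0 z) (fun=> x))
| null_step f (i : 'I_(ar f)) k (t : A -> ('I_k -> M) -> A) : (1 < ar f)%N ->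
    null_op t ->
    null_op (fun x (zy : 'I_((ar f).-1 + k) -> M) =>
      act1 D i (insert i 0 (fun j => zy (lshift k j)))
               (fun=> t x (fun j => zy (rshift (ar f).-1 j)))).

(* The condition defining A^I, for a subset K of M in place of I. *)
Variable K : M -> Prop.
Definition nullified (a : A) : Prop :=
  forall k (t : A -> ('I_k -> M) -> A), null_op t ->
  forall m : 'I_k -> M, (exists j, K (m j)) -> t a m = 0.

Definition null_pred : {pred A} := fun a => `[< nullified a >].

Lemma null_op_linear k (t : A -> ('I_k -> M) -> A) (m : 'I_k -> M) :
  null_op t -> linear (fun x => t x m).
Proof.
move=> ht; elim: ht m => {k t} [f i _|f i k t _ _ IH] m r u v.
  by rewrite -act1_lin.
by rewrite -act1_lin; apply: act1_dep => //; rewrite IH.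
Qed.

Lemma null_submod_closed : submod_closed null_pred.
Proof.
split=> [|r a b /asboolP ha /asboolP hb]; apply/asboolP => k t ht m mK.
  exact: (linear_at0 (null_op_linear m ht)).
by rewrite (null_op_linear m ht) ha// hb// scaler0 addr0.
Qed.
HB.instance Definition _ := GRing.isSubmodClosed.Build R A null_pred null_submod_closed.

Record null := MkNull { null_val :> A; _ : null_val \in null_pred }.
HB.instance Definition _ := [isSub for null_val].
HB.instance Definition _ := [Choice of null by <:].
HB.instance Definition _ := [SubChoice_isSubLmodule of null by <:].

(* A^I as an (abelian) algebra. *)
Definition null_sub : xmod R ar := @Xmod R F ar null (fun f _ => 0).

Lemma null_op_comp f (i : 'I_(ar f)) k (t : A -> ('I_k -> M) -> A) :
  (1 < ar f)%N -> null_op t ->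
  exists (k' : nat) (t' : A -> ('I_k' -> M) -> A), null_op t' /\
    forall (y : 'I_k -> M) (z : 'I_(ar f).-1 -> M), exists y' : 'I_k' -> M,
      (forall x, t' x y' = t (act1 D i (insert i 0 z) (fun=> x)) y) /\
      (forall j, exists j', y' j' = y j).
Proof.
move=> n1; elim=> {k t} [g j g1|g j k t g1 _ [k' [t' [ht' tE]]]].
  exists ((ar g).-1 + (ar f).-1)%N; eexists; split.
    exact: (@null_step g j _ _ g1 (null_base i n1)).
  move=> y z; exists (fun l => match fintype.split l with inl a => y a | inr a => z a end).
  split=> [x|a]; last by exists (lshift _ a); rewrite -[lshift _ _]/(unsplit (inl a)) unsplitK.
  congr (act1 _ _ _ _).
    by apply/funext => l; rewrite /insert; case: unlift => // a;
      rewrite -[lshift _ _]/(unsplit (inl a)) unsplitK.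
  apply/funext => _; congr (act1 _ _ _ _).
  by apply/funext => l; rewrite /insert; case: unlift => // a;
      rewrite -[rshift _ _]/(unsplit (inr a)) unsplitK.
exists ((ar g).-1 + k')%N; eexists; split; first exact: (@null_step g j _ _ g1 ht').
move=> y z; have [y' [y'E y'I]] := tE (fun l => y (rshift _ l)) z.
exists (fun l => match fintype.split l with inl a => y (lshift k a) | inr a => y' a end).
have sl a : fintype.split (lshift k' a : 'I_((ar g).-1 + k')) = inl a.
  by rewrite -[lshift _ _]/(unsplit (inl a)) unsplitK.
have sr a : fintype.split (rshift (ar g).-1 a : 'I_((ar g).-1 + k')) = inr a.
  by rewrite -[rshift _ _]/(unsplit (inr a)) unsplitK.
split=> [x|l].
  congr (act1 _ _ _ _).
    by apply/funext => l; rewrite /insert; case: unlift => // a; rewrite sl.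
  apply/funext => _; rewrite -y'E; congr (t' _ _).
  by apply/funext => l; rewrite sr.
have -> : l = unsplit (fintype.split l) by rewrite splitK.
case: (fintype.split l) => a /=; first by exists (lshift _ a); rewrite sl.
by have [l' l'E] := y'I a; exists (rshift _ l'); rewrite sr.
Qed.

Lemma null_act1 f (i : 'I_(ar f)) (q : 'I_(ar f) -> M) (b : 'I_(ar f) -> null) :
  act1 D i q (fun j => b j) \in null_pred.
Proof.
have [n1|n1] := boolP (1 < ar f)%N; last first.
  by rewrite /act1 (negPf n1); exact: rpred0.
apply/asboolP => k t ht m [j mK].
have [k' [t' [ht' tE]]] := null_op_comp i n1 ht.
have [y' [y'E y'I]] := tE m (fun l => q (lift i l)).
have -> : act1 D i q (fun j => b j) =
    act1 D i (insert i 0 (fun l => q (lift i l))) (fun=> b i : A).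
  apply: act1_dep => // l li; rewrite /insert.
  by case: unliftP li => [l' ->|->] //; rewrite eqxx.
rewrite -y'E; have /asboolP := valP (b i); apply=> //.
by have [j' yj'] := y'I j; exists j'; rewrite yj'.
Qed.

Lemma null_act1_K f (i j : 'I_(ar f)) (q : 'I_(ar f) -> M) (b : 'I_(ar f) -> null) :
  j != i -> K (q j) -> act1 D i q (fun l => b l) = 0.
Proof.
move=> ji qK; have [n1|n1] := boolP (1 < ar f)%N; last by rewrite /act1 (negPf n1).
have /asboolP := valP (b i) => /(_ _ _ (null_base i n1) (fun l => q (lift i l))).
have [l jl _] : {l | j = lift i l & unlift i j = Some l}.
  by apply: unlift_some; rewrite eq_sym.
rewrite jl in qK *; move=> /(_ (ex_intro _ l qK)) <-.
apply: act1_dep => // h hi; rewrite /insert.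
by case: unliftP hi => [h' ->|->] //; rewrite eqxx.
Qed.

(* The action of N on A^K through phi : N -> M.  For s in [n]^* the value of
   a(f,s) lies in A^K and the default of insubd is not used ([restrict_actionE]). *)
Definition restrict_action (N : xmod R ar) (phi : N -> M) : action N null_sub :=
  fun f s q b => insubd (0 : null) (act D f s (fun j => phi (q j)) (fun j => val (b j : null))).

Lemma restrict_actionE (N : xmod R ar) (phi : N -> M) f s
    (q : 'I_(ar f) -> N) (b : 'I_(ar f) -> null_sub) : nontrivial s ->
  val (restrict_action phi s q b : null) =
  act D f s (fun j => phi (q j)) (fun j => val (b j : null)).
Proof.
move=> nts; rewrite val_insubd.
suff -> : act D f s (fun j => phi (q j)) (fun j => val (b j : null)) \in null_pred by [].
have /andP[s0 _] := nts.
have [s1|s1] := leqP #|s| 1; last by rewrite datum_unary// rpred0.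
have /cards1P[i si] : #|s| == 1%N by rewrite eqn_leq s1 card_gt0.
have n1 : (1 < ar f)%N by rewrite -(nontrivial1 i) -si.
by have := null_act1 i (fun j => phi (q j)) b; rewrite /act1 n1 -si.
Qed.

Lemma restrict_act1E (N : xmod R ar) (phi : N -> M) f (i : 'I_(ar f))
    (q : 'I_(ar f) -> N) (b : 'I_(ar f) -> null_sub) :
  val (act1 (restrict_action phi) i q b : null) =
  act1 D i (fun j => phi (q j)) (fun j => val (b j : null)).
Proof.
by rewrite /act1; case: ifP => // n1; apply: restrict_actionE; rewrite nontrivial1.
Qed.

Lemma restrict_action_terms (N : xmod R ar) (phi : N -> M) :
  phi 0 = 0 -> action_terms (restrict_action phi).
Proof.
move=> phi0; split=> [f s nts q q' b b' hq hb|f s nts q b j js|f s nts q b [j js q0]].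
- apply: val_inj; rewrite !restrict_actionE//.
  apply: (act_dep (datum_terms D)) => // j js; first by rewrite hq.
  by rewrite hb.
- move=> r u v; apply: val_inj; rewrite linearP /= !restrict_actionE//.
  have updE w : (fun k => val (upd b j w k : null)) = upd (fun k => val (b k : null)) j (val (w : null)).
    by apply/funext => k; rewrite /upd; case: eqP.
  by rewrite !updE linearP /=; apply: (act_lin (datum_terms D)).
- apply: val_inj; rewrite restrict_actionE//.
  by apply: (act_vanish (datum_terms D)) => //; exists j => //; rewrite q0.
Qed.

Lemma null_sub_variety : in_variety E (algebra_of null_sub).
Proof.
apply: (in_variety_inj (B := algebra_of A) (phi := fun a : algebra_of null_sub => val (a : null))).
- by split=> //= f x; rewrite (datum_abelian D).
- exact: val_inj.
- exact: datum_B D.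
Qed.

Lemma restrict_unary (N : xmod R ar) (phi : N -> M) f s : nontrivial s -> (1 < #|s|)%N ->
  forall (q : 'I_(ar f) -> N) (b : 'I_(ar f) -> null_sub), restrict_action phi s q b = 0.
Proof.
by move=> nts s1 q b; apply: val_inj; rewrite restrict_actionE// datum_unary.
Qed.

Lemma restrict_compat (N : xmod R ar) (phi : N -> M) :
  xmod_hom phi -> injective phi -> in_variety E (semidirect (restrict_action phi)).
Proof.
move=> [phil phio] phii.
pose psi (u : semidirect (restrict_action phi)) : semidirect D :=
  (val (u.1 : null), phi u.2).
have phi0 := linear_at0 phil.
have phiD x y : phi (x + y) = phi x + phi y by have := phil 1 x y; rewrite !scale1r.
have phiZ r x : phi (r *: x) = r *: phi x by have := phil r x 0; rewrite phi0 !addr0.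
apply: (in_variety_inj (phi := psi)).
- split=> [|u v|u|r u|f u]; rewrite /psi /=.
  + by rewrite phi0.
  + by rewrite phiD !addr0.
  + by rewrite -[in LHS]scaleN1r phiZ scaleN1r !subr0.
  + by rewrite phiZ !addr0.
  + rewrite phio !addr0 add0r (datum_abelian D) add0r; congr pair.
    have vsum (J : finType) (p : pred J) (g : J -> null) :
        val (\sum_(s | p s) g s) = \sum_(s | p s) val (g s) by exact: raddf_sum.
    transitivity (val (\sum_(s : {set 'I_(ar f)} | nontrivial s)
      (restrict_action phi s (fun i => (u i).2) (fun i => (u i).1) : null))) => //.
    by rewrite vsum; apply: eq_bigr => s nts; exact: restrict_actionE.
- by move=> [a x] [b y] [/val_inj -> /phii ->].
- exact: datum_compat.
Qed.

Definition restrict_datum (N : xmod R ar) (phi : N -> M) (hphi : xmod_hom phi)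
    (iphi : injective phi) : affine_datum E N null_sub :=
  AffineDatum (restrict_action_terms (linear_at0 (xhom_linear hphi)))
    (in_variety_inj
       (A := algebra_of N) (B := algebra_of M) (phi := phi)
       (algebra_of_hom hphi) iphi (datum_P D))
    null_sub_variety (fun _ _ => erefl) (restrict_compat hphi iphi)
    (restrict_unary phi).

End NullSubmodule.

Arguments restrict_action {R F ar E M A} D K {N} phi f s q b.
Arguments restrict_action_terms {R F ar E M A} D K {N} phi _.
Arguments restrict_unary {R F ar E M A} D K {N} phi [f s] _ _ q b.

Section Extension.
Context {R : pzRingType} {F : Type} {ar : F -> nat}.
Context {E : term R ar nat -> term R ar nat -> Prop} {I M Q A : xmod R ar}.

Definition is_lifting (pi : M -> Q) (l : Q -> M) : Prop := l 0 = 0 /\ cancel l pi.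

(* T and b are the factor sets and the action terms of the 2-cocycle of the
   extension determined by the lifting l; I is embedded in M by iota. *)
Record extension_cocycle (iota : I -> M) (l : Q -> M) (T : factors Q I)
    (b : action Q I) : Prop := ExtensionCocycle {
  cocycle_add : forall x y, iota (fs_add T x y) = l x + l y - l (x + y);
  cocycle_scale : forall r x, iota (fs_scale T r x) = r *: l x - l (r *: x);
  cocycle_op : forall f (x : 'I_(ar f) -> Q),
    iota (fs_op T x) = xop (fun j => l (x j)) - l (xop x);
  cocycle_action : forall f (s : {set 'I_(ar f)}), nontrivial s ->
    forall (x : 'I_(ar f) -> Q) (c : 'I_(ar f) -> I),
    iota (b f s x c) = xop (fun j => if j \in s then iota (c j) else l (x j)) }.

Variable D : affine_datum E M A.
Variables (iota : I -> M) (pi : M -> Q) (hext : is_extension E iota pi).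
Variables (l : Q -> M) (hl : is_lifting pi l).

Definition image_iota (m : M) : Prop := exists b, iota b = m.

Definition AI : xmod R ar := null_sub D image_iota.

Let id_hom : xmod_hom (id : M -> M).
Proof. by split. Qed.

Definition datum_M : affine_datum E M AI := restrict_datum D image_iota id_hom (@inj_id M).
Definition datum_I : affine_datum E I AI :=
  restrict_datum D image_iota (ext_iota hext) (ext_inj hext).

Lemma act1_pi f (i : 'I_(ar f)) (q q' : 'I_(ar f) -> M) (b : 'I_(ar f) -> null D image_iota) :
  (forall j, pi (q j) = pi (q' j)) ->
  act1 D i q (fun j => b j) = act1 D i q' (fun j => b j).
Proof.
move=> qq'; pose mix (r : seq 'I_(ar f)) j := if j \in r then q' j else q j.
suff mixE r : act1 D i (mix r) (fun j => b j) = act1 D i q (fun j => b j).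
  by rewrite -(mixE (enum 'I_(ar f))); apply: act1_dep => // j _; rewrite /mix mem_enum.
elim: r => [|k r <-]; first exact: act1_dep.
have [ki|ki] := eqVneq k i.
  by apply: act1_dep => // j ji; rewrite /mix inE ki (negPf ji).
have -> : mix (k :: r) = upd (mix r) k (mix r k + (q' k - mix r k)).
  apply/funext => j; rewrite /mix /upd inE; case: eqP => //= ->.
  by rewrite addrC subrK.
rewrite act1_addq// [X in _ + X](null_act1_K (j := k)) ?addr0//.
rewrite /upd eqxx; apply/(ext_exact hext).
have := linear_at0 (xhom_linear (ext_pi hext)) => pi0.
have := xhom_linear (ext_pi hext) (-1) (mix r k) (q' k).
rewrite !scaleN1r [- mix r k + _]addrC => ->.
by rewrite /mix; case: ifP; rewrite ?qq' addNr.
Qed.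

(* The choice of l is immaterial, by [hat_actionE]. *)
Definition hat_action : action Q AI := restrict_action D image_iota l.

Lemma hat_actionE f (s : {set 'I_(ar f)}) : nontrivial s ->
  forall (m : 'I_(ar f) -> M) (a : 'I_(ar f) -> AI),
  hat_action s (fun j => pi (m j)) a = act datum_M f s m a.
Proof.
move=> nts m a; apply: val_inj; rewrite !restrict_actionE//.
have [s1|s1] := leqP #|s| 1; last by rewrite !datum_unary.
have /andP[s0 _] := nts.
have /cards1P[i si] : #|s| == 1%N by rewrite eqn_leq s1 card_gt0.
have n1 : (1 < ar f)%N by rewrite -(nontrivial1 i) -si.
have := act1_pi i (q := fun j => l (pi (m j))) (q' := m) a.
by rewrite /act1 n1 -si; apply=> j; rewrite (proj2 hl).
Qed.

Lemma hat_variety : in_variety E (algebra_of Q).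
Proof.
apply: (in_variety_surj (A := algebra_of M) (B := algebra_of Q) (phi := pi)).
- exact: algebra_of_hom (ext_pi hext).
- exact: (ext_surj hext).
- exact: ext_variety hext.
Qed.

Lemma hat_compat : in_variety E (semidirect hat_action).
Proof.
have ph := algebra_of_hom (ext_pi hext).
apply: (in_variety_surj
  (phi := fun u : semidirect datum_M => ((u.1, pi u.2) : semidirect hat_action))).
- split=> [|u v|u|r u|f u].
  + by rewrite /= (ahom0 ph).
  + by rewrite /= (ahomD ph).
  + by rewrite /= (ahomN ph).
  + by rewrite /= (ahomZ ph).
  + rewrite /=; congr pair; last exact: (ahom_op ph).
    congr (_ + _ + _); apply: eq_bigr => s nts.
    by rewrite -[RHS]/(hat_action _ _ _) hat_actionE.
- by move=> [a x]; have [m <-] := ext_surj hext x; exists (a, m).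
- exact: datum_compat datum_M.
Qed.

Definition datum_Q : affine_datum E Q AI :=
  AffineDatum (restrict_action_terms D image_iota l (proj1 hl)) hat_variety
    (null_sub_variety (D := D) (K := image_iota)) (fun _ _ => erefl) hat_compat
    (restrict_unary D image_iota l).

Definition square (b : action Q I) (d : I -> AI) : Prop :=
  exists h : Q -> AI,
  forall f (s : {set 'I_(ar f)}), nontrivial s ->
  forall (x : 'I_(ar f) -> Q) (c : 'I_(ar f) -> I),
  let u := fun j => if j \in s then iota (c j) else l (x j) in
  d (b f s x c) = \sum_(i | i \notin s) act1 datum_M i u (fun j => h (x j))
                + \sum_(i in s) act1 datum_M i u (fun j => d (c j)).

Variable b : action Q I.

Definition h1sq_pred : {pred H1 datum_I} :=
  fun x => `[< exists2 d : Der datum_I, square b d & class1 d = x >].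

Lemma h1sq_zmod_closed : zmod_closed h1sq_pred.
Proof.
split=> [|x y /asboolP[d [h hE] <-] /asboolP[d' [h' hE'] <-]]; apply/asboolP.
  exists 0; last exact: raddf0.
  exists (fun=> 0) => f s nts x c u.
  by rewrite !big1 ?addr0// => i _; apply: act1_0.
exists (d - d'); last exact: raddfB.
exists (fun z => h z - h' z) => f s nts z c u.
have dE w : (d - d' : Der datum_I) w = d w - d' w by [].
rewrite dE hE// hE'// -/u opprD addrACA -!sumrB.
by congr (_ + _); apply: eq_bigr => i _; rewrite -act1B.
Qed.
HB.instance Definition _ :=
  GRing.isZmodClosed.Build (H1 datum_I) h1sq_pred h1sq_zmod_closed.

(* The subgroup of square classes of H^1(I, A^I), as a group. *)
Record H1sq := MkH1sq { h1sq_val :> H1 datum_I; _ : h1sq_val \in h1sq_pred }.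
HB.instance Definition _ := [isSub for h1sq_val].
HB.instance Definition _ := [Choice of H1sq by <:].
HB.instance Definition _ := [SubChoice_isSubZmodule of H1sq by <:].

Definition is_inflation1 (sigma : H1 datum_Q -> H1 datum_M) : Prop :=
  forall d : Der datum_Q, exists2 e : Der datum_M,
    (forall m, e m = d (pi m)) & sigma (class1 d) = class1 e.

Definition is_restriction (r : H1 datum_M -> H1sq) : Prop :=
  forall d : Der datum_M, exists2 e : Der datum_I,
    (forall x, e x = d (iota x)) & h1sq_val (r (class1 d)) = class1 e.

Definition comp_cocycle (d : I -> AI) (T : factors Q I) : factors Q AI :=
  Factors (fun x y => d (fs_add T x y)) (fun r x => d (fs_scale T r x))
    (fun f x => d (fs_op T x)).

Definition is_transgression (T : factors Q I) (delta : H1sq -> H2 datum_Q) : Prop :=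
  forall (x : H1sq) (d : Der datum_I), square b d -> class1 d = h1sq_val x ->
  exists2 S : Z2 datum_Q,
    z2_factors S = comp_cocycle d T & delta x = class2 S.

Definition inflate_factors (S : factors Q AI) : factors M AI :=
  Factors (fun x y => fs_add S (pi x) (pi y)) (fun r x => fs_scale S r (pi x))
    (fun f x => fs_op S (fun j => pi (x j))).

Definition is_inflation2 (sigma : H2 datum_Q -> H2 datum_M) : Prop :=
  forall S : Z2 datum_Q, exists2 S' : Z2 datum_M,
    z2_factors S' = inflate_factors S & sigma (class2 S) = class2 S'.

End Extension.

Definition exact_at (U V W : zmodType) (f : U -> V) (g : V -> W) : Prop :=
  forall y, g y = 0 <-> exists x, f x = y.

(* Main.v *)
From HB Require Import structures.
Require Import Defs.
From mathcomp Require Import all_boot all_order all_algebra.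
From mathcomp Require Import boolp.

Set Implicit Arguments.
Unset Strict Implicit.
Unset Printing Implicit Defensive.

Import GRing.Theory.
Local Open Scope ring_scope.

(** Put [N = A^I]. Every element of [M] is uniquely [iota (rho m) + l (pi m)], and
    the proof rests on the map [rho : M -> I].

    By definition of [N], the action terms of [M] on [N] vanish as soon as one of
    their [M]-arguments lies in [I]. So [M] acts through [Q], and [I] acts by
    zero. A derivation on [I] is then a linear map killing all products, a
    principal derivation on [I] is zero ([principal_I]), so that a class in
    [H^1(I, N)] is a single map, and the square condition reduces to
    [d (b(f,s)(x, c)) = a(f,s)(x, d c)] ([square_act]).

    Expanding an operation at [iota (rho m) + l (pi m)] by multilinearity gives,
    for a square derivation [d] ([square_rho_op]),
      [d (rho (f m)) = sum_i a(f,i)(pi m, d (rho m)) + d (T_f (pi m))],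
    together with the evident analogues for sums and scalar multiples. This
    identity has three consequences.
    - The map [<a, m> |-> <a + d (rho m), pi m>] is a surjective homomorphism
      from the semidirect product of [N] and [M] onto the extension of [Q] by
      [N] with cocycle [d o T]. So [d o T] is compatible with the variety
      ([transgression_compatible]).
    - If [d o T] is the coboundary of [h], then [d o rho + h o pi] is a
      derivation on [M] extending [d] ([derivation_extend]).
    - [d o T o pi] is the coboundary of [- d o rho]
      ([coboundary_inflate_transgression]).

    Conversely, let [S o pi] be the coboundary of [h : M -> N]. As [S] is
    normalized, [h (iota c + m) = h (iota c) + h m], and [h] obeys the derivation
    rule on every product with a factor in [I]. Hence [d = - h o iota] is a
    square derivation, and [d o T - S] is the coboundary of [- h o l]
    ([inflate_coboundary]).

    On [H^1], a derivation is principal exactly when it is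
    [x |-> t(<0,x>, c)] for a term [t] and parameters [c] ([principalP]). Since [M]
    acts on [N] through [Q], a derivation [d] on [Q] is principal if and only if
    [d o pi] is ([principal_inflate]), and principal derivations on [M] vanish
    on [I] ([principal_M_iota]). *)

(** * Multilinearity of the operations *)

Section Multilinear.
Context {R : pzRingType} {F : Type} {ar : F -> nat}.
Context {E : term R ar nat -> term R ar nat -> Prop} {A : xmod R ar}.
Hypothesis hA : in_variety E (algebra_of A).

Lemma xop_updD f (i : 'I_(ar f)) (x : 'I_(ar f) -> A) (y : A) :
  xop (upd x i (x i + y)) = xop x + xop (upd x i y).
Proof.
pose v (k : nat) : algebra_of A := if insub k is Some j then x j else y.
have vE (j : 'I_(ar f)) : v j = x j by rewrite /v valK.
have vn : v (ar f) = y by rewrite /v insubF// ltnn.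
have := hA (or_introl (ax_opD i)) v => /= h.
transitivity (xop (fun j => eval v (upd (fun j : 'I_(ar f) => Var ar (val j)) i
   (Add (Var ar (val i)) (Var ar (ar f))) j)) : A).
  by congr (xop _); apply/funext => j; rewrite /upd; case: eqP => _ /=; rewrite ?vE ?vn.
rewrite h; congr (_ + _); congr xop; apply/funext => j; first exact: vE.
by rewrite /upd; case: eqP => _ /=; rewrite ?vE ?vn.
Qed.

Lemma xop0 f (x : 'I_(ar f) -> A) : (exists i, x i = 0) -> xop x = 0.
Proof.
move=> [i xi]; apply: (addrI (xop x)); rewrite addr0.
have {2}-> : x = upd x i 0 by apply/funext => j; rewrite /upd; case: eqP => [->|].
rewrite -xop_updD; congr xop; apply/funext => j.
by rewrite /upd addr0; case: eqP => [->|].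
Qed.

Lemma xop_expand_sub f (s : {set 'I_(ar f)}) (u v : 'I_(ar f) -> A) :
  xop (fun j => if j \in s then u j + v j else v j) =
  \sum_(p : {set 'I_(ar f)} | p \subset s) xop (fun j => if j \in p then u j else v j).
Proof.
elim: {s}#|s| {-2}s (erefl #|s|) v => [|n IH] s.
  move=> /eqP; rewrite cards_eq0 => /eqP -> v.
  rewrite (big_pred1 set0) => [|p]; last by rewrite subset0.
  by congr xop; apply/funext => j; rewrite inE.
move=> sn v; have /card_gt0P[i si] : (0 < #|s|)%N by rewrite sn.
have sn' : #|s :\ i| = n by move: sn; rewrite (cardsD1 i) si => -[].
(* Splitting the coordinate i leaves the same expansion over s :\ i, once with
   v and once with v replaced at i by u. *)
pose w := upd v i (u i).
have -> : (fun j => if j \in s then u j + v j else v j) =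
    upd (fun j => if j \in s :\ i then u j + v j else v j) i
      ((if i \in s :\ i then u i + v i else v i) + u i).
  apply/funext => j; rewrite /upd !inE.
  by case: eqP => [->|_] /=; rewrite ?eqxx /= ?si // addrC.
rewrite xop_updD IH//.
have -> : upd (fun j => if j \in s :\ i then u j + v j else v j) i (u i) =
    (fun j => if j \in s :\ i then u j + w j else w j).
  apply/funext => j; rewrite /upd /w /upd !inE.
  by case: eqP => [->|_].
rewrite IH// [RHS](bigID (fun p : {set _} => i \notin p)) /=; congr (_ + _).
  by apply: eq_bigl => p; rewrite subsetD1.
rewrite [RHS](reindex_onto (fun p => i |: p) (fun p => p :\ i)) /=; last first.
  by move=> p /andP[_]; rewrite negbK => /setD1K.
apply: eq_big => p.
  rewrite subUset sub1set si setU11 /= andbT subsetD1; congr (_ && _).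
  apply/idP/eqP => [ip|<-]; last by rewrite setD11.
  by apply/setP => j; rewrite !inE; case: eqP => // ->; rewrite (negPf ip).
move=> _; congr xop; apply/funext => j; rewrite /w /upd !inE.
by case: eqP => [->|] //=; case: ifP.
Qed.

Lemma xop_expand f (u v : 'I_(ar f) -> A) :
  xop (fun j => u j + v j) =
  \sum_(s : {set 'I_(ar f)}) xop (fun j => if j \in s then u j else v j).
Proof.
transitivity (xop (fun j => if j \in [set: 'I_(ar f)] then u j + v j else v j)).
  by congr xop; apply/funext => j; rewrite inE.
by rewrite xop_expand_sub; apply: eq_bigl => s; rewrite subsetT.
Qed.

End Multilinear.

(** * Principal derivations *)

Section Principal.
Context {R : pzRingType} {F : Type} {ar : F -> nat}.
Context {E : term R ar nat -> term R ar nat -> Prop} {P B : xmod R ar}.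
Variable D : affine_datum E P B.

Lemma eval_semidirect2 X (v : X -> semidirect D) (t : term R ar X) :
  (eval v t).2 = eval (A := algebra_of P) (fun x => (v x).2) t.
Proof. exact: (@eval_hom _ _ _ (semidirect D) (algebra_of P) (fun z => z.2)). Qed.

(** As [B] is abelian, a term operation of the semidirect product is additive
    in the [B]-components of its arguments. *)
Lemma eval_semidirect1D X (a b : X -> B) (x : X -> P) (t : term R ar X) :
  (eval (A := semidirect D) (fun o => (a o + b o, x o)) t).1 =
  (eval (A := semidirect D) (fun o => (a o, x o)) t).1 +
  (eval (A := semidirect D) (fun o => (b o, x o)) t).1.
Proof.
elim: t => //= [|t IHt u IHu|t IHt|r t IHt|f ts IH].
- by rewrite addr0.
- by rewrite !addr0 IHt IHu addrACA.
- by rewrite !subr0 IHt opprD.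
- by rewrite !addr0 IHt scalerDr.
- rewrite !(datum_abelian D) !add0r !addr0 !sum_action -big_split.
  apply: eq_bigr => i _ /=.
  have -> : (fun j => (eval (A := semidirect D) (fun o => (a o + b o, x o)) (ts j)).1) =
      (fun j => (eval (A := semidirect D) (fun o => (a o, x o)) (ts j)).1
                + (eval (A := semidirect D) (fun o => (b o, x o)) (ts j)).1).
    by apply/funext => j.
  rewrite act1D; congr (_ + _); congr (act1 _ _ _ _);
    by apply/funext => j; rewrite !eval_semidirect2.
Qed.

(** A map vanishing at 0 is principal exactly when it is [x |-> t(<0,x>, c)] for a
    term [t] with parameters [c] in [B]. *)
Lemma principalP (d : P -> B) : d 0 = 0 ->
  principal D d <->
  exists (k : nat) (t : term R ar (option 'I_k)) (c : 'I_k -> B),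
    forall x, d x = (poly_eval (D := D) t c (0, x)).1.
Proof.
move=> d0; split=> [[_ [k [t [c [e tE]]]]]|[k [t [c tE]]]].
  exists k, (Opp t), c => x; have [+ _] := tE (0, x).
  move=> /(congr1 fst) /= h.
  by rewrite /poly_eval /= subr0 -[eval _ _]/(poly_eval t c _) -h /= sub0r opprK.
split; first by exists (0, 0); rewrite /gamma /= d0 subr0.
(* The term z - (t(z, y) - t(z, y')) has P-component z.2 whatever t is, and it
   is the identity of the semidirect product at y = y' = 0. *)
pose left (o : option 'I_k) : option 'I_(k + k) := omap (lshift k) o.
pose right (o : option 'I_k) : option 'I_(k + k) := omap (@rshift k k) o.
pose glue (y : 'I_k -> B) (j : 'I_(k + k)) := if fintype.split j is inl i then y i else 0.
have evl y z : poly_eval (D := D) (rename left t) (glue y) z = poly_eval t y z.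
  rewrite /poly_eval eval_renameE; congr eval; apply/funext => -[j|] //=.
  by rewrite /glue -[lshift _ _]/(unsplit (inl j)) unsplitK.
have evr y z : poly_eval (D := D) (rename right t) (glue y) z = poly_eval t (fun=> 0) z.
  rewrite /poly_eval eval_renameE; congr eval; apply/funext => -[j|] //=.
  by rewrite /glue -[rshift _ _]/(unsplit (inr j)) unsplitK.
exists (k + k)%N, (Add (Var ar None)
  (Opp (Add (rename left t) (Opp (rename right t))))), (glue c), (glue (fun=> 0)).
have evE (y : 'I_k -> B) a x : (poly_eval (D := D) t y (a, x)).1 =
    (poly_eval (D := D) t (fun=> 0) (a, x)).1 + (poly_eval (D := D) t y (0, x)).1.
  pose aa (o : option 'I_k) := if o is Some _ then 0 else a.
  pose yy (o : option 'I_k) := if o is Some j then y j else 0.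
  pose xx (o : option 'I_k) := if o is Some j then 0 else x.
  pose env b o := (b o, xx o) : semidirect D.
  have e1 : (fun o : option 'I_k => if o is Some j then (y j, 0) else (a, x)) =
      env (fun o => aa o + yy o).
    by apply/funext => -[j|]; rewrite /env /= ?add0r ?addr0.
  have e2 : (fun o : option 'I_k => if o is Some j then (0, 0) else (a, x)) = env aa.
    by apply/funext => -[j|].
  have e3 : (fun o : option 'I_k => if o is Some j then (y j, 0) else (0, x)) = env yy.
    by apply/funext => -[j|].
  by rewrite /poly_eval e1 e2 e3; apply: eval_semidirect1D.
have sndE y z : (poly_eval (D := D) t y z).2 = (poly_eval (D := D) t (fun=> 0) z).2.
  rewrite /poly_eval !eval_semidirect2.
  by apply: (congr1 (fun v => eval (A := algebra_of P) v t)); apply/funext => -[].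
have main y z : poly_eval (D := D) (Add (Var ar None)
    (Opp (Add (rename left t) (Opp (rename right t))))) (glue y) z =
    (z.1 - (poly_eval (D := D) t y (0, z.2)).1, z.2).
  case: z => a x; rewrite /poly_eval /= -/(poly_eval _ _ _) -/(poly_eval _ _ _) evl evr.
  congr pair; last by rewrite sndE subrr oppr0 addr0.
  by rewrite evE !addr0 !subr0 [X in a - (X - _)]addrC addrK.
move=> z; rewrite !main /gamma tE; split=> //.
have t00 : (poly_eval (D := D) t (fun=> 0) (0, z.2)).1 = 0.
  by apply: (addrI (poly_eval (D := D) t (fun=> 0) (0, z.2)).1); rewrite -evE addr0.
by rewrite t00 subr0; case: z {t00}.
Qed.

(** When all action terms vanish, [t(<0,x>, c)] has a [B]-component independent
    of [x]. *)
Lemma principal_trivial_action (d : P -> B) :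
  (forall f, (0 < ar f)%N) ->
  (forall f (i : 'I_(ar f)) q b, act1 D i q b = 0) ->
  d 0 = 0 -> principal D d -> forall x, d x = 0.
Proof.
move=> ar_gt0 a0 d0 /(principalP d0)[k [t [c tE]]] x.
pose zero2 (z : semidirect D) : semidirect D := (z.1, 0).
have zh : alg_hom zero2.
  split=> [|u v|u|r u|f u]; rewrite /zero2 /=.
  - by [].
  - by rewrite !addr0.
  - by rewrite !subr0 oppr0.
  - by rewrite !addr0 scaler0.
  - rewrite !(datum_abelian D) !sum_action !big1 => [|i _|i _]; rewrite ?a0//.
    by rewrite (xop0 (datum_P D)); last by exists (Ordinal (ar_gt0 f)).
suff e : (poly_eval (D := D) t c (0, x)).1 = (poly_eval (D := D) t c (0, 0)).1.
  by rewrite tE e -tE.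
rewrite -[LHS]/(zero2 _).1 /poly_eval eval_hom//.
by apply: (congr1 (fun v => (eval (A := semidirect D) v t).1)); apply/funext => -[].
Qed.

End Principal.

(** * Maps out of a quotient group *)

Lemma quot_pi_eq0 (U : zmodType) (S : zmodClosed U) (x : U) :
  (\pi_(Quotient.quot S)%qT x = 0) <-> x \in S.
Proof.
have <- : \pi_(Quotient.quot S)%qT 0 = 0 by exact: raddf0.
by rewrite -[x in x \in S]subr0 Quotient.idealrBE; split=> [->|/eqP].
Qed.

Lemma quot_lift (U V : zmodType) (S : zmodClosed U) (g : U -> V) :
  {morph g : x y / x - y} -> (forall x, x \in S -> g x = 0) ->
  exists h : {additive Quotient.quot S -> V},
    forall x, h (\pi_(Quotient.quot S)%qT x) = g x.
Proof.
move=> gB gS.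
have reprE x : g (repr (\pi_(Quotient.quot S)%qT x)) = g x.
  apply/eqP; rewrite -subr_eq0 -gB; apply/eqP/gS.
  by rewrite Quotient.idealrBE reprK.
pose h (x : Quotient.quot S) := g (repr x).
have hB : zmod_morphism h.
  move=> x y; rewrite -[x]reprK -[y]reprK -raddfB /h !reprE.
  by rewrite gB.
pose hM := GRing.isZmodMorphism.Build _ _ h hB.
pose H : {additive Quotient.quot S -> V} := HB.pack h hM.
by exists H.
Qed.

(** * Linear maps given as bare functions *)

Section LinearFunctions.
Context {R : pzRingType} {U V : lmodType R} {d : U -> V}.
Hypothesis dl : linear d.

Lemma linear_funD x y : d (x + y) = d x + d y.
Proof. by have := dl 1 x y; rewrite !scale1r. Qed.

Lemma linear_funZ r x : d (r *: x) = r *: d x.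
Proof. by have := dl r x 0; rewrite (linear_at0 dl) !addr0. Qed.

Lemma linear_funN x : d (- x) = - d x.
Proof. by rewrite -scaleN1r linear_funZ scaleN1r. Qed.

Lemma linear_funB x y : d (x - y) = d x - d y.
Proof. by rewrite linear_funD linear_funN. Qed.

Lemma linear_fun_sum (J : finType) (p : pred J) (g : J -> U) :
  d (\sum_(j | p j) g j) = \sum_(j | p j) d (g j).
Proof. exact: (big_morph d linear_funD (linear_at0 dl)). Qed.

End LinearFunctions.

(** * The three actions on the null submodule *)

Section Sequence.
Context {R : pzRingType} {F : Type} {ar : F -> nat}.
Hypothesis ar_gt0 : forall f, (0 < ar f)%N.
Context {E : term R ar nat -> term R ar nat -> Prop} {I M Q A : xmod R ar}.
Context {iota : I -> M} { pi : M -> Q} (hext : is_extension E iota pi).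
Context {l : Q -> M} (hl : is_lifting pi l).
Context {T : factors Q I} {b : action Q I} (hT : extension_cocycle iota l T b).
Variable D : affine_datum E M A.

Local Notation N := (AI D iota).
Local Notation dM := (datum_M D iota).
Local Notation dI := (datum_I D hext).
Local Notation dQ := (datum_Q D hext hl).

Let iotal := xhom_linear (ext_iota hext).
Let pil := xhom_linear (ext_pi hext).

Lemma pi_iota c : pi (iota c) = 0.
Proof. by apply/(ext_exact hext); exists c. Qed.

(** An argument in [I] off the place [i] annihilates [a(f,i)] on [A^I]. *)
Lemma act1_M_ker f (i j : 'I_(ar f)) q (a : 'I_(ar f) -> N) :
  j != i -> pi (q j) = 0 -> act1 dM i q a = 0.
Proof.
move=> ji /(ext_exact hext) qj; apply: val_inj; rewrite restrict_act1E.
exact: (null_act1_K (j := j)).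
Qed.

Lemma act1_Q f (i : 'I_(ar f)) q (a : 'I_(ar f) -> N) :
  act1 dQ i (fun j => pi (q j)) a = act1 dM i q a.
Proof.
rewrite /act1; case: ifP => // n1.
by apply: (hat_actionE hext hl); rewrite nontrivial1.
Qed.

Lemma act1_I f (i : 'I_(ar f)) q (a : 'I_(ar f) -> N) : act1 dI i q a = 0.
Proof.
have [n1|n1] := boolP (1 < ar f)%N; last by rewrite /act1 (negPf n1).
have -> : act1 dI i q a = act1 dM i (fun j => iota (q j)) a.
  by apply: val_inj; rewrite !restrict_act1E.
have [j ji] : exists j : 'I_(ar f), j != i.
  have /card_gt0P[j] : (0 < #|[set~ i]|)%N.
    by rewrite cardsC1 card_ord; case: (ar f) n1 => [|[]].
  by rewrite !inE; exists j.
by apply: (act1_M_ker _ ji); apply: pi_iota.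
Qed.

(** A derivation on [I] is thus a linear map vanishing on all products. *)
Lemma derivation_I_op d : derivation dI d ->
  forall f (x : 'I_(ar f) -> I), d (xop x) = 0.
Proof. by move=> [_ dop] f x; rewrite dop big1// => i _; apply: act1_I. Qed.

(** The terms in [h] of the square condition vanish, since each of them has an
    argument in [I] off the place where [h] is inserted. What remains says that
    [d] intertwines the action terms of the extension with the action of [Q]
    on [A^I]. *)
Lemma square_act d : square l b d ->
  forall f (s : {set 'I_(ar f)}), nontrivial s -> forall x c,
  d (b s x c) = act dQ f s x (fun j => d (c j)).
Proof.
move=> [h hE] f s nts x c; rewrite hE//.
set u := fun j => if j \in s then iota (c j) else l (x j).
have us j : j \in s -> pi (u j) = 0 by move=> js; rewrite /u js pi_iota.
have /andP[/set0Pn[k ks] _] := nts.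
rewrite big1 ?add0r => [|i is_]; last first.
  by apply: (act1_M_ker _ (j := k)) (us _ ks); apply: contraNneq is_ => <-.
have [s1|s1] := leqP #|s| 1; last first.
  rewrite datum_unary// big1// => i is_.
  have /card_gt0P[j] : (0 < #|s :\ i|)%N by move: s1; rewrite (cardsD1 i) is_.
  by rewrite !inE => /andP[ji js]; apply: (act1_M_ker _ ji (us _ js)).
have /cards1P[i si] : #|s| == 1%N.
  by rewrite eqn_leq s1 card_gt0; apply/set0Pn; exists k.
have n1 : (1 < ar f)%N by rewrite -(nontrivial1 i) -si.
rewrite {1}si big_set1 -act1_Q.
transitivity (act1 dQ i x (fun j => d (c j))); last by rewrite /act1 n1 -si.
apply: act1_dep => // j ji.
by rewrite /u si inE (negPf ji) (proj2 hl).
Qed.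

(** * The coordinate of M along I *)

(** Every element of [M] is [iota (rho m) + l (pi m)], and [T] and [b] measure
    the failure of [rho] to be a homomorphism. *)
Variable rho : M -> I.
Hypothesis rhoE : forall m, iota (rho m) = m - l (pi m).

Lemma rhoK m : m = iota (rho m) + l (pi m).
Proof. by rewrite rhoE subrK. Qed.

Lemma rho_iota c : rho (iota c) = c.
Proof. by apply: (ext_inj hext); rewrite rhoE pi_iota (proj1 hl) subr0. Qed.

Lemma rhoD m n : rho (m + n) = rho m + rho n + fs_add T (pi m) (pi n).
Proof.
apply: (ext_inj hext); rewrite !(linear_funD iotal) !rhoE (cocycle_add hT).
rewrite (linear_funD pil) addrA; congr (_ - _).
by rewrite [X in _ = X]addrACA !subrK.
Qed.

Lemma rhoZ r m : rho (r *: m) = r *: rho m + fs_scale T r (pi m).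
Proof.
apply: (ext_inj hext); rewrite (linear_funD iotal) (linear_funZ iotal) !rhoE.
by rewrite (cocycle_scale hT) (linear_funZ pil) scalerBr addrA subrK.
Qed.

Lemma rho_op f (m : 'I_(ar f) -> M) :
  rho (xop m) = xop (fun j => rho (m j)) +
    \sum_(s : {set 'I_(ar f)} | nontrivial s) b s (fun j => pi (m j)) (fun j => rho (m j))
    + fs_op T (fun j => pi (m j)).
Proof.
apply: (ext_inj hext); rewrite !(linear_funD iotal) rhoE (cocycle_op hT).
rewrite (xhom_op (ext_pi hext)) addrA; congr (_ - _).
rewrite (xhom_op (ext_iota hext)) (linear_fun_sum iotal).
have {1}-> : m = (fun j => iota (rho (m j)) + l (pi (m j))).
  by apply/funext => j; rewrite -rhoK.
rewrite (xop_expand (ext_variety hext)).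
rewrite (bigD1 setT)//= -[RHS]addrA; congr (_ + _).
  by congr xop; apply/funext => j; rewrite inE.
have nT : (set0 : {set 'I_(ar f)}) != setT.
  by apply/eqP => /setP/(_ (Ordinal (ar_gt0 f))); rewrite !inE.
rewrite (bigD1 set0)//= addrC; congr (_ + _); last first.
  by congr xop; apply/funext => j; rewrite inE.
apply: eq_big => [s|s /andP[sT s0]]; first by rewrite andbC.
by rewrite (cocycle_action hT)// /nontrivial s0.
Qed.

(** For a square derivation [d], the composite [d o rho] respects the
    derivation rule on [M] up to the error [d o T]. This rests on the multilinear
    expansion of an operation at [iota (rho m) + l (pi m)]. *)
Lemma square_rho_op d : derivation dI d -> square l b d ->
  forall f (m : 'I_(ar f) -> M),
  d (rho (xop m)) = \sum_i act1 dQ i (fun j => pi (m j)) (fun j => d (rho (m j)))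
                    + d (fs_op T (fun j => pi (m j))).
Proof.
move=> dd dsq f m; have [dl _] := dd.
rewrite rho_op !(linear_funD dl) derivation_I_op// add0r (linear_fun_sum dl).
rewrite -sum_action; congr (_ + _); apply: eq_bigr => s nts.
exact: square_act.
Qed.

(** * Inflation, restriction and transgression of cochains *)

Lemma derivation_inflate d : derivation dQ d -> derivation dM (fun m => d (pi m)).
Proof.
move=> [dl dop]; split=> [r x y|f x]; first by rewrite pil dl.
by rewrite (xhom_op (ext_pi hext)) dop; apply: eq_bigr => i _; rewrite act1_Q.
Qed.

Lemma derivation_restrict e : derivation dM e -> derivation dI (fun c => e (iota c)).
Proof.
move=> [el eop]; split=> [r x y|f x]; first by rewrite iotal el.
rewrite (xhom_op (ext_iota hext)) eop; apply: eq_bigr => i _.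
by apply: val_inj; rewrite !restrict_act1E.
Qed.

Lemma square_restrict e : derivation dM e -> square l b (fun c => e (iota c)).
Proof.
move=> [el eop]; exists (fun x => e (l x)) => f s nts x c /=.
rewrite (cocycle_action hT)// eop (bigID (fun i => i \notin s)) /=.
congr (_ + _).
  by apply: eq_bigr => i is_; apply: (act1_dep dM); rewrite ?(negPf is_).
apply: eq_big => [i|i is_]; first by rewrite negbK.
by apply: (act1_dep dM); rewrite // -[i \in s]negbK is_.
Qed.

(** A derivation on [M] vanishing on [I] descends to [Q]. *)
Lemma derivation_descend e : derivation dM e -> (forall c, e (iota c) = 0) ->
  derivation dQ (fun x => e (l x)) /\ forall m, e (l (pi m)) = e m.
Proof.
move=> [el eop] e0.
have epi m : e (l (pi m)) = e m.
  by rewrite [in RHS](rhoK m) (linear_funD el) e0 add0r.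
have e_pi m n : pi m = pi n -> e m = e n by rewrite -(epi m) -(epi n) => ->.
split=> //; split=> [r x y|f x].
  rewrite -el; apply: e_pi.
  by rewrite (proj2 hl) pil !(proj2 hl).
transitivity (e (xop (fun j => l (x j)))).
  apply: e_pi; rewrite (proj2 hl) (xhom_op (ext_pi hext)).
  by congr xop; apply/funext => j; rewrite (proj2 hl).
rewrite eop; apply: eq_bigr => i _; rewrite -act1_Q.
by apply: act1_dep => // j _; rewrite (proj2 hl).
Qed.

(** As [M] acts on [A^I] through [Q], the [A^I]-component of a term operation
    depends on its [M]-arguments only through [pi]. *)
Lemma eval_semidirect_pi X (v : X -> semidirect dM) (t : term R ar X) :
  (eval v t).1 =
  (eval (A := semidirect dQ) (fun o => ((v o).1, pi (v o).2)) t).1.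
Proof.
pose phi (u : semidirect dM) : semidirect dQ := (u.1, pi u.2).
rewrite -[LHS]/(phi _).1 eval_hom//.
have ph := algebra_of_hom (ext_pi hext).
split=> [|u w|u|r u|f u]; rewrite /phi /=.
- by rewrite (ahom0 ph).
- by rewrite (ahomD ph).
- by rewrite (ahomN ph).
- by rewrite (ahomZ ph).
- congr pair; last exact: (ahom_op ph).
  rewrite (sum_action dM) (sum_action dQ); congr (_ + _ + _).
  by apply: eq_bigr => i _; rewrite act1_Q.
Qed.

Lemma poly_eval_pi k (t : term R ar (option 'I_k)) (c : 'I_k -> N) m :
  (poly_eval (D := dM) t c (0, m)).1 = (poly_eval (D := dQ) t c (0, pi m)).1.
Proof.
rewrite /poly_eval eval_semidirect_pi.
apply: (congr1 (fun v => (eval (A := semidirect dQ) v t).1)).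
by apply/funext => -[j|] //=; rewrite (linear_at0 pil).
Qed.

Lemma principal_inflate d : d 0 = 0 ->
  principal dM (fun m => d (pi m)) <-> principal dQ d.
Proof.
move=> d0; rewrite !principalP ?(linear_at0 pil)//.
split=> -[k [t [c tE]]]; exists k, t, c => x; last by rewrite tE poly_eval_pi.
by have [m <-] := ext_surj hext x; rewrite tE poly_eval_pi.
Qed.

Lemma principal_M_iota e : e 0 = 0 -> principal dM e -> forall c, e (iota c) = 0.
Proof.
move=> e0 /(principalP dM e0)[k [t [c tE]]] x.
by rewrite tE poly_eval_pi pi_iota -(linear_at0 pil) -poly_eval_pi -tE.
Qed.

Lemma principal_I d : d 0 = 0 -> principal dI d -> forall c, d c = 0.
Proof. by apply: principal_trivial_action => // f i q a; apply: act1_I. Qed.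

(** For a square derivation [d], the extension of [Q] by [A^I] with cocycle
    [d o T] is a quotient of the semidirect product of [A^I] and [M]. *)
Lemma transgression_compatible d : derivation dI d -> square l b d ->
  compatible_cocycle dQ (comp_cocycle d T).
Proof.
move=> dd dsq; have [dl _] := dd; have d0 := linear_at0 dl.
have [l0 lK] := hl; have iota0 := linear_at0 iotal.
split.
  have dT c : iota c = 0 -> d c = 0.
    by rewrite -iota0 => /(ext_inj hext) ->.
  split=> [x|x|r|f x x0] /=; apply: dT.
  - by rewrite (cocycle_add hT) l0 !addr0 subrr.
  - by rewrite (cocycle_add hT) l0 !add0r subrr.
  - by rewrite (cocycle_scale hT) l0 !scaler0 l0 subrr.
  - rewrite (cocycle_op hT) (xop0 (hat_variety hext) x0) l0 subr0.
    by apply: (xop0 (ext_variety hext)); have [i xi] := x0; exists i; rewrite xi.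
pose phi (u : semidirect dM) : cocycle_ext (comp_cocycle d T) dQ :=
  (u.1 + d (rho u.2), pi u.2).
apply: (in_variety_surj (phi := phi)) (datum_compat dM).
  split=> [|u v|u|r u|f u]; rewrite /phi /=.
  - by rewrite -{1}iota0 rho_iota d0 addr0 (linear_at0 pil).
  - rewrite rhoD !(linear_funD dl) (linear_funD pil) addr0; congr pair.
    by rewrite addrA [in RHS]addrACA.
  - have rhoN m : rho (- m) = - rho m - fs_add T (pi m) (- pi m).
      apply: (addrI (rho m)); rewrite addrA subrr sub0r.
      apply: (addIr (fs_add T (pi m) (- pi m))).
      rewrite addNr -(linear_funN pil) -rhoD subrr.
      by rewrite -{1}iota0 rho_iota.
    rewrite rhoN (linear_funB dl) !(linear_funN dl) (linear_funN pil).
    by rewrite subr0 opprD addrA.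
  - rewrite rhoZ (linear_funD dl) !(linear_funZ dl) (linear_funZ pil).
    by rewrite addr0 scalerDr addrA.
  - rewrite (xhom_op (ext_pi hext)); congr pair.
    rewrite (sum_action dM) (sum_action dQ) square_rho_op// !add0r addr0 addrA.
    congr (_ + _); rewrite -big_split; apply: eq_bigr => i _ /=.
    by rewrite -act1_Q -(act1D dQ).
move=> [a x]; exists (a - d (rho (l x)), l x).
by rewrite /phi /= subrK lK.
Qed.

Lemma deviation_inflate S X (v : X -> M) (t : term R ar X) :
  deviation dM (inflate_factors pi S) v t = deviation dQ S (fun o => pi (v o)) t.
Proof.
have piE u : pi (eval (A := algebra_of M) v u) =
    eval (A := algebra_of Q) (fun o => pi (v o)) u.
  by rewrite -(eval_hom _ _ (algebra_of_hom (ext_pi hext))).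
elim: t => //= [t IHt u IHu|t IHt|r t IHt|f ts IH].
- by rewrite IHt IHu !piE.
- by rewrite IHt (linear_funN pil) !piE.
- by rewrite IHt piE.
- congr (_ + _); last first.
    by apply: (congr1 (@fs_op _ _ _ _ _ S f)); apply/funext => j; rewrite piE.
  apply: eq_bigr => i _; rewrite -act1_Q.
  by apply: (act1_dep dQ) => [j _|]; rewrite ?piE ?IH.
Qed.

Lemma inflate_compatible S : compatible_cocycle dQ S ->
  compatible_cocycle dM (inflate_factors pi S).
Proof.
have pi0 := linear_at0 pil.
move=> [nS /compatibleE cS]; split; last first.
  by apply/compatibleE => t u tu v; rewrite !deviation_inflate; apply: cS.
split=> [x|x|r|f x [i xi]] /=.
- by rewrite pi0 norm_addr.
- by rewrite pi0 norm_addl.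
- by rewrite pi0 norm_scale.
- by rewrite norm_op//; exists i; rewrite xi.
Qed.

Lemma coboundary_inflate S : coboundary dQ S -> coboundary dM (inflate_factors pi S).
Proof.
move=> [h [h0 hD hZ ho]]; exists (fun m => h (pi m)).
split=> [|x y|r x|f x] /=.
- by rewrite (linear_at0 pil).
- by rewrite hD (linear_funD pil).
- by rewrite hZ (linear_funZ pil).
- rewrite ho (xhom_op (ext_pi hext)); congr (_ - _).
  by apply: eq_bigr => i _; rewrite act1_Q.
Qed.

(** * Exactness at the level of cochains *)

(** If [d o T] is the coboundary of [h], then [d o rho + h o pi] extends [d]. *)
Lemma derivation_extend d : derivation dI d -> square l b d ->
  coboundary dQ (comp_cocycle d T) ->
  exists2 e, derivation dM e & forall c, e (iota c) = d c.
Proof.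
move=> dd dsq [h [h0 /= hD hZ ho]]; have [dl _] := dd.
exists (fun m => d (rho m) + h (pi m)); last first.
  by move=> c; rewrite rho_iota pi_iota h0 addr0.
split=> [r x y|f x].
  rewrite rhoD rhoZ !(linear_funD dl) (linear_funZ dl) hD hZ.
  rewrite (linear_funD pil) (linear_funZ pil) -[LHS]addrA subrK scalerDr.
  by rewrite addrACA -[X in X + _ = _]addrA subrK.
rewrite square_rho_op// ho (xhom_op (ext_pi hext)) addrA subrK -big_split.
by apply: eq_bigr => i _ /=; rewrite -act1_Q -(act1D dQ).
Qed.

Lemma coboundary_restrict e : derivation dM e ->
  coboundary dQ (comp_cocycle (fun c => e (iota c)) T).
Proof.
move=> [el eop]; exists (fun x => e (l x)); split=> [|x y|r x|f x] /=.
- by rewrite (proj1 hl) (linear_at0 el).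
- by rewrite (cocycle_add hT) (linear_funB el) (linear_funD el).
- by rewrite (cocycle_scale hT) (linear_funB el) (linear_funZ el).
- by rewrite (cocycle_op hT) (linear_funB el) eop.
Qed.

(** On [M], the cocycle [d o T o pi] is the coboundary of [- d o rho]. *)
Lemma coboundary_inflate_transgression d : derivation dI d -> square l b d ->
  coboundary dM (inflate_factors pi (comp_cocycle d T)).
Proof.
move=> dd dsq; have [dl _] := dd.
exists (fun m => - d (rho m)); split=> [|x y|r x|f x] /=.
- by rewrite -(linear_at0 iotal) rho_iota (linear_at0 dl) oppr0.
- by rewrite rhoD !(linear_funD dl) opprK addrA -opprD addNr add0r.
- by rewrite rhoZ (linear_funD dl) (linear_funZ dl) opprK scalerN addrA addNr add0r.
- rewrite square_rho_op// opprK addrA -big_split big1 ?add0r// => i _ /=.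
  rewrite -act1_Q -(act1D dQ) -(act1_0 dQ i (fun j => pi (x j))).
  by congr (act1 dQ i _ _); apply/funext => j; rewrite addNr.
Qed.

(** If [S o pi] is the coboundary of [h], then [- h] restricted to [I] is a
    square derivation whose transgression is cohomologous to [S]. *)
Lemma inflate_coboundary S : compatible_cocycle dQ S ->
  coboundary dM (inflate_factors pi S) ->
  exists d, [/\ derivation dI d, square l b d & coboundary dQ (comp_cocycle d T - S)].
Proof.
move=> [nS _] [h [h0 /= hD hZ ho]]; have [l0 lK] := hl.
have hDl c m : h (iota c + m) = h (iota c) + h m.
  have := hD (iota c) m; rewrite pi_iota norm_addl// => /esym/eqP.
  by rewrite subr_eq0 => /eqP.
have hZi r c : h (r *: iota c) = r *: h (iota c).
  have := hZ r (iota c); rewrite pi_iota norm_scale// => /esym/eqP.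
  by rewrite subr_eq0 => /eqP.
have hop f (u : 'I_(ar f) -> M) : (exists i, pi (u i) = 0) ->
    h (xop u) = \sum_i act1 dM i u (fun j => h (u j)).
  move=> u0; have := ho f u; rewrite norm_op// => /esym/eqP.
  by rewrite subr_eq0 => /eqP.
have act1N f (i : 'I_(ar f)) q (a : 'I_(ar f) -> N) :
    act1 dM i q (fun j => - a j) = - act1 dM i q a.
  rewrite -[RHS]sub0r -(act1_0 dM i q) -act1B.
  by congr (act1 dM i q _); apply/funext => j; rewrite sub0r.
exists (fun c => - h (iota c)); split.
- split=> [r x y|f x].
    rewrite (linear_funD iotal) hDl (linear_funZ iotal) hZi.
    by rewrite opprD scalerN.
  rewrite (xhom_op (ext_iota hext)) hop; last first.
    by exists (Ordinal (ar_gt0 f)); apply: pi_iota.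
  rewrite -sumrN; apply: eq_bigr => i _; rewrite act1_I -act1N.
  by apply: val_inj; have := act1_I i x (fun j => - h (iota (x j)));
    move=> /(congr1 val); rewrite !restrict_act1E.
- exists (fun x => - h (l x)) => f s nts x c /=.
  rewrite (cocycle_action hT)// hop; last first.
    have /andP[/set0Pn[k ks] _] := nts.
    by exists k; rewrite ks pi_iota.
  rewrite -sumrN (bigID (fun i => i \notin s)) /=; congr (_ + _).
    apply: eq_bigr => i is_; rewrite -(act1N _ _ _ (fun j => h _)).
    by apply: (act1_dep dM); rewrite ?(negPf is_).
  apply: eq_big => [i|i is_]; first by rewrite negbK.
  rewrite -(act1N _ _ _ (fun j => h _)).
  by apply: (act1_dep dM); rewrite // -[i \in s]negbK is_.
(* The hypothesis is used at (l x, l y), whose image under pi is (x, y). *)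
- have hT_ c m n : iota c = m - n -> h (iota c) = h m - h n.
    by move=> cmn; rewrite -[m](subrK n) -cmn hDl addrK.
  exists (fun x => - h (l x)); split=> [|x y|r x|f x] /=.
  + by rewrite l0 h0 oppr0.
  + rewrite (hT_ _ _ _ (cocycle_add hT x y)).
    have := hD (l x) (l y); rewrite !lK => ->.
    by rewrite !opprB addrA subrK opprK addrC opprD.
  + rewrite (hT_ _ _ _ (cocycle_scale hT r x)).
    have := hZ r (l x); rewrite !lK => ->.
    by rewrite !opprB addrA subrK opprK addrC scalerN.
  + rewrite (hT_ _ _ _ (cocycle_op hT x)).
    have := ho f (fun j => l (x j)).
    have -> : (fun j => pi (l (x j))) = x by apply/funext => j; rewrite lK.
    move=> ->; rewrite !opprB addrA subrK opprK addrC -sumrN; congr (_ + _).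
    apply: eq_bigr => i _; rewrite -act1N -act1_Q.
    by apply: (act1_dep dQ) => // j _; rewrite lK.
Qed.

(** * Cohomology classes *)

Lemma derP (P B : xmod R ar) (D' : affine_datum E P B) (d : Der D') : derivation D' d.
Proof. by case: d => d dd; apply/asboolP. Qed.

Lemma der0 (P B : xmod R ar) (D' : affine_datum E P B) (d : Der D') : d 0 = 0.
Proof. exact: linear_at0 (proj1 (derP d)). Qed.

(** A derivation, or a compatible cocycle, as an element of its group. *)
Definition der_of (P B : xmod R ar) (D' : affine_datum E P B) d
  (dd : derivation D' d) : Der D' := MkDer (asboolT dd).

Definition z2_of (P B : xmod R ar) (D' : affine_datum E P B) S
  (cS : compatible_cocycle D' S) : Z2 D' := MkZ2 (asboolT cS).

Lemma z2P (P B : xmod R ar) (D' : affine_datum E P B) (S : Z2 D') :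
  compatible_cocycle D' S.
Proof. by case: S => S cS; apply/asboolP. Qed.

Lemma class1_eq0 (P B : xmod R ar) (D' : affine_datum E P B) (d : Der D') :
  class1 d = 0 <-> principal D' d.
Proof. by rewrite /class1 quot_pi_eq0; split=> /asboolP. Qed.

Lemma class1B (P B : xmod R ar) (D' : affine_datum E P B) (d e : Der D') :
  class1 (d - e) = class1 d - class1 e.
Proof. exact: raddfB. Qed.

Lemma class1_surj (P B : xmod R ar) (D' : affine_datum E P B) (x : H1 D') :
  exists d, class1 d = x.
Proof. by exists (repr x); apply: reprK. Qed.

Lemma class2_eq0 (P B : xmod R ar) (D' : affine_datum E P B) (S : Z2 D') :
  class2 S = 0 <-> coboundary D' S.
Proof. by rewrite /class2 quot_pi_eq0; split=> /asboolP. Qed.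

Lemma class2B (P B : xmod R ar) (D' : affine_datum E P B) (S S' : Z2 D') :
  class2 (S - S') = class2 S - class2 S'.
Proof. exact: raddfB. Qed.

Lemma class2_surj (P B : xmod R ar) (D' : affine_datum E P B) (x : H2 D') :
  exists S, class2 S = x.
Proof. by exists (repr x); apply: reprK. Qed.

(** As [PDer(I, A^I) = 0], a class determines its derivation. *)
Lemma class1_I_inj : injective (@class1 _ _ _ _ _ _ dI).
Proof.
move=> d e de; apply: val_inj; apply/funext => c.
have /class1_eq0 h : class1 (d - e) = 0 by rewrite class1B de subrr.
have := principal_I (der0 (d - e)) h c => /eqP.
by rewrite -[_ c]/(d c - e c) subr_eq0 => /eqP.
Qed.

Lemma h1sq_surj (x : H1sq D hext l b) :
  exists2 d : Der dI, square l b d & class1 d = h1sq_val x.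
Proof. by case: x => x sx; apply/asboolP. Qed.

Lemma inflation1_exists : exists sigma : {additive H1 dQ -> H1 dM}, is_inflation1 sigma.
Proof.
pose infl (d : Der dQ) : Der dM := der_of (derivation_inflate (derP d)).
have [] := @quot_lift _ _ (pder_pred (D := dQ)) (fun d => class1 (infl d)).
- by move=> d e; rewrite -class1B; congr class1; apply: val_inj.
- move=> d /asboolP pd; apply/class1_eq0.
  exact/(principal_inflate (der0 d)).
- by move=> sigma sE; exists sigma => d; exists (infl d) => //; apply: sE.
Qed.

Lemma restriction_exists :
  exists r : {additive H1 dM -> H1sq D hext l b}, is_restriction r.
Proof.
pose restr (e : Der dM) : Der dI := der_of (derivation_restrict (derP e)).
pose g (e : Der dM) : H1sq D hext l b :=
  MkH1sq (asboolT (ex_intro2 (fun d : Der dI => square l b d)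
    (fun d => class1 d = class1 (restr e)) (restr e) (square_restrict (derP e)) erefl)).
have [] := @quot_lift _ _ (pder_pred (D := dM)) g.
- move=> d e; apply: val_inj; rewrite raddfB /= -class1B; congr class1.
  exact: val_inj.
- move=> e /asboolP pe; apply: val_inj; rewrite raddf0 /=.
  have -> : restr e = 0.
    apply: val_inj; apply/funext => c.
    exact: principal_M_iota (der0 e) pe c.
  exact: raddf0.
- move=> r rE; exists r => e; exists (restr e) => //.
  by have := congr1 (@h1sq_val _ _ _ _ _ _ _ _ _ _ _ _ _ _) (rE e).
Qed.

Lemma transgression_exists :
  exists delta : {additive H1sq D hext l b -> H2 dQ}, is_transgression T delta.
Proof.
have sq (x : H1sq D hext l b) : square l b (repr (h1sq_val x)).
  have [d dsq dx] := h1sq_surj x.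
  suff -> : repr (h1sq_val x) = d by [].
  by apply: class1_I_inj; rewrite dx; apply: reprK.
pose g (x : H1sq D hext l b) : Z2 dQ :=
  z2_of (transgression_compatible (derP (repr (h1sq_val x))) (sq x)).
have gB : zmod_morphism (fun x => class2 (g x)).
  move=> x y; rewrite -class2B; congr class2; apply: val_inj => /=.
  have -> : repr (h1sq_val (x - y)) = repr (h1sq_val x) - repr (h1sq_val y).
    apply: class1_I_inj; rewrite class1B.
    by rewrite /class1 !reprK; exact: (raddfB \val).
  by [].
pose gM := GRing.isZmodMorphism.Build _ _ (fun x => class2 (g x)) gB.
pose delta : {additive H1sq D hext l b -> H2 dQ} := HB.pack (fun x => class2 (g x)) gM.
exists delta => x d dsq dx; exists (g x) => //=.
suff -> : repr (h1sq_val x) = d by [].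
by apply: class1_I_inj; rewrite dx; apply: reprK.
Qed.

Lemma inflation2_exists : exists sigma : {additive H2 dQ -> H2 dM}, is_inflation2 sigma.
Proof.
pose infl (S : Z2 dQ) : Z2 dM := z2_of (inflate_compatible (z2P S)).
have [] := @quot_lift _ _ (b2_pred (D := dQ)) (fun S => class2 (infl S)).
- by move=> S S'; rewrite -class2B; congr class2; apply: val_inj.
- by move=> S /asboolP cS; apply/class2_eq0; apply: coboundary_inflate.
- by move=> sigma sE; exists sigma => S; exists (infl S) => //; apply: sE.
Qed.

(** * Exactness *)

Lemma inflation1_inj (sigma : {additive H1 dQ -> H1 dM}) :
  is_inflation1 sigma -> injective sigma.
Proof.
move=> sE; apply: raddf_inj => x; have [d <-] := class1_surj x.
have [e eE ->] := sE d => /class1_eq0 pe; apply/class1_eq0.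
apply/(principal_inflate (der0 d)).
by have <- : der_fun e = (fun m => d (pi m)) by apply/funext.
Qed.

Lemma exact_H1_M (sigma : {additive H1 dQ -> H1 dM})
    (r : {additive H1 dM -> H1sq D hext l b}) :
  is_inflation1 sigma -> is_restriction r -> exact_at sigma r.
Proof.
move=> sE rE y; split=> [|[x <-]]; last first.
  have [d <-] := class1_surj x; have [e eE ->] := sE d.
  apply: val_inj; rewrite raddf0 /=; have [e' e'E ->] := rE e.
  have -> : e' = 0.
    by apply: val_inj; apply/funext => c; rewrite /= e'E eE pi_iota der0.
  exact: raddf0.
have [e <-] := class1_surj y; have [d dE red] := rE e => re0.
have d0 : d = 0.
  apply: class1_I_inj; rewrite -red re0; transitivity (0 : H1 dI).
    exact: (raddf0 \val).
  by apply/esym; apply: raddf0.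
have eI c : e (iota c) = 0 by rewrite -dE d0.
have [de epi] := derivation_descend (derP e) eI.
exists (class1 (der_of de)); have [e' e'E ->] := sE (der_of de).
by congr class1; apply: val_inj; apply/funext => m; rewrite /= e'E /= epi.
Qed.

Lemma exact_H1_I (r : {additive H1 dM -> H1sq D hext l b})
    (delta : {additive H1sq D hext l b -> H2 dQ}) :
  is_restriction r -> is_transgression T delta -> exact_at r delta.
Proof.
move=> rE dE y; split=> [|[x <-]]; last first.
  have [e <-] := class1_surj x; have [d dres rx] := rE e.
  have de : der_fun d = (fun c => e (iota c)) by apply/funext.
  have dsq : square l b d by rewrite de; apply: square_restrict (derP e).
  have [S SE ->] := dE (r (class1 e)) d dsq (esym rx).
  by apply/class2_eq0; rewrite SE de; apply: coboundary_restrict (derP e).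
have [d dsq dy] := h1sq_surj y; have [S SE ->] := dE y d dsq dy.
move=> /class2_eq0; rewrite SE => /(derivation_extend (derP d) dsq)[e de eE].
exists (class1 (der_of de)); apply: val_inj => /=.
have [d' d'E ->] := rE (der_of de); rewrite -dy; congr class1.
by apply: val_inj; apply/funext => c; rewrite /= d'E /= eE.
Qed.

Lemma exact_H2_Q (delta : {additive H1sq D hext l b -> H2 dQ})
    (sigma : {additive H2 dQ -> H2 dM}) :
  is_transgression T delta -> is_inflation2 sigma -> exact_at delta sigma.
Proof.
move=> dE sE y; split=> [|[x <-]]; last first.
  have [d dsq dx] := h1sq_surj x; have [S SE ->] := dE x d dsq dx.
  have [S' S'E ->] := sE S; apply/class2_eq0; rewrite S'E SE.
  exact: coboundary_inflate_transgression (derP d) dsq.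
have [S <-] := class2_surj y; have [S' S'E ->] := sE S.
move=> /class2_eq0; rewrite S'E => /(inflate_coboundary (z2P S))[d [dd dsq cob]].
pose x : H1sq D hext l b := MkH1sq (asboolT (ex_intro2 (fun d' : Der dI => square l b d')
  (fun d' => class1 d' = class1 (der_of dd)) (der_of dd) dsq erefl)).
exists x; have [U UE ->] := dE x (der_of dd) dsq erefl.
apply/eqP; rewrite -subr_eq0 -class2B; apply/eqP/class2_eq0.
by rewrite -[z2_factors (U - S)]/(z2_factors U - z2_factors S) UE.
Qed.

End Sequence.

Theorem theorem5p1 (R : pzRingType) (F : Type) (ar : F -> nat)
    (ar_gt0 : forall f, (0 < ar f)%N)
    (E : term R ar nat -> term R ar nat -> Prop)
    (I M Q A : xmod R ar)
    (iota : I -> M) (pi : M -> Q) (hext : is_extension E iota pi)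
    (l : Q -> M) (hl : is_lifting pi l)
    (T : factors Q I) (b : action Q I) (hT : extension_cocycle iota l T b)
    (D : affine_datum E M A) :
  exists (sigma1 : {additive H1 (datum_Q D hext hl) -> H1 (datum_M D iota)})
         (r : {additive H1 (datum_M D iota) -> H1sq D hext l b})
         (delta : {additive H1sq D hext l b -> H2 (datum_Q D hext hl)})
         (sigma2 : {additive H2 (datum_Q D hext hl) -> H2 (datum_M D iota)}),
    [/\ is_inflation1 sigma1, is_restriction r,
        is_transgression T delta & is_inflation2 sigma2] /\
    [/\ injective sigma1, exact_at sigma1 r,
        exact_at r delta & exact_at delta sigma2].
Proof.
have [rho rhoE] : exists rho : M -> I, forall m, iota (rho m) = m - l (pi m).
  have ex m : exists c, iota c = m - l (pi m).
    apply/(ext_exact hext).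
    by rewrite (linear_funB (xhom_linear (ext_pi hext))) (proj2 hl) subrr.
  by have [rho rhoE] := choice ex; exists rho.
have [sigma1 sigma1E] := inflation1_exists hext hl D.
have [r rE] := restriction_exists hext hl hT D.
have [delta deltaE] := transgression_exists ar_gt0 hext hl hT D rhoE.
have [sigma2 sigma2E] := inflation2_exists hext hl D.
exists sigma1, r, delta, sigma2; split; split=> //.
- exact: inflation1_inj sigma1E.
- exact: exact_H1_M rhoE _ _ sigma1E rE.
- exact: exact_H1_I rE deltaE.
- exact: exact_H2_Q deltaE sigma2E.
Qed.
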